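(* Let $V:S^1\to\mathbb{R}$ be of class $C^{k-1,1}(S^1)$ with $k\ge1$ and let $\phi(\theta)=e^{-V(\theta)}$. Let $\gamma_n>0$ be the leading coefficient of the orthonormal polynomial $p_n$ of degree $n$ with respect to $\phi$ on the unit circle, and let $V_0=\frac{1}{2\pi}\int_{-\pi}^\pi V(\theta)d\theta$. Then there is a constant $K>0$ such that \[ \left|\gamma_n^2e^{-V_0}-1\right|\le K\frac{\log(n)}{n^{2k}} \] for all sufficiently large $n$.
   Context: $C^{k-1,1}(S^1)$: functions on the circle whose periodic extension has $k-1$ Lipschitz continuous derivatives. The orthonormal polynomials $p_n(z)=\gamma_nz^n+\dots$, $\gamma_n>0$, satisfy $\langle p_m,p_n\rangle_\phi=\delta_{mn}$ where $\langle f,g\rangle_\phi=\frac{1}{2\pi}\int_{-\pi}^{\pi}f(e^{i\theta})\overline{g(e^{i\theta})}\phi(\theta)d\theta$. *)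

(* Defs.v *)
From Stdlib Require Import Reals.
From Coquelicot Require Import Coquelicot.
Open Scope R_scope.

(* V : R -> R represents a function on S^1 via theta |-> V(e^{i theta}):
   2pi-periodic, k-1 times differentiable everywhere, with Lipschitz (k-1)-th derivative. *)
Definition C_k_minus_1_1_S1 (k : nat) (V : R -> R) : Prop :=
  (forall x, V (x + 2 * PI) = V x) /\
  (forall (j : nat) (x : R), (j <= k - 1)%nat -> ex_derive_n V j x) /\
  (exists L : R, forall x y : R,
      Rabs (Derive_n V (k - 1) x - Derive_n V (k - 1) y) <= L * Rabs (x - y)).

Definition eit (t : R) : C := (cos t, sin t).

Definition poly_eval (a : nat -> C) (n : nat) (z : C) : C :=
  sum_n (G := C_AbelianMonoid) (fun j => Cmult (a j) (Cpow z j)) n.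

Definition ip_re (phi : R -> R) (f g : C -> C) : R :=
  / (2 * PI) * RInt (fun t => Re (Cmult (f (eit t)) (Cconj (g (eit t)))) * phi t) (- PI) PI.
Definition ip_im (phi : R -> R) (f g : C -> C) : R :=
  / (2 * PI) * RInt (fun t => Im (Cmult (f (eit t)) (Cconj (g (eit t)))) * phi t) (- PI) PI.

(* p n j = j-th coefficient of p_n (only j <= n used); p_n(z) = sum_{j<=n} p n j z^j,
   orthonormal w.r.t. phi, with leading coefficient gamma_n = p n n real and > 0. *)
Definition orthonormal_family (phi : R -> R) (p : nat -> nat -> C) : Prop :=
  (forall m n : nat,
      ip_re phi (poly_eval (p m) m) (poly_eval (p n) n) = (if Nat.eqb m n then 1 else 0) /\
      ip_im phi (poly_eval (p m) m) (poly_eval (p n) n) = 0) /\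
  (forall n : nat, Im (p n n) = 0 /\ 0 < Re (p n n)).

(* Main.v *)
Require Import Defs.
From Stdlib Require Import Reals Lra Lia List.
From Coquelicot Require Import Coquelicot.
Open Scope R_scope.

(** Write F(z) = sum_(j >= 1) V_j z^j, so that V = V0 + 2 Re F on the circle and the
    weight is phi = exp(-V0) |exp(-F)|^2.  The number gamma_n^(-2) is the minimum of the
    mean of |P|^2 phi over polynomials P of degree n with P(0) = 1 (after reversing the
    coefficients).  Since P exp(-F) has mean P(0), this minimum is at least exp(-V0).
    Conversely take for P the Taylor polynomial of degree n of exp F: then
    P exp(-F) - 1 has mean 0, so the mean of |P|^2 phi is exp(-V0) times
    1 + mean |P exp(-F) - 1|^2, and the excess is at most a constant times the
    sum over j > n of |q_j|^2, where exp F = sum_j q_j z^j.  The l^2 norm with weight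
    (j+1)^k satisfies |ab| <= C |a| |b| under convolution, hence the weighted norm of q is
    bounded in terms of that of (V_j), which is finite by Bessel's inequality applied to
    difference quotients of the Lipschitz function V^(k-1).  This gives the rate n^(-2k),
    without the logarithm.

    No infinite series occur: V is replaced by its Fejer means, and exp(-F), exp F by the
    polynomials (1 - F/m)^m, (1 + F/m)^m.  All bounds are uniform in these approximations. *)

(** * Means over one period *)

Definition is_mean (f : R -> R) (m : R) : Prop :=
  is_RInt f (- PI) PI (2 * PI * m).

(** Names a value for every [f]; the relation [is_mean] also carries integrability, so that its
    rules of linearity have no side conditions. *)
Definition mean (f : R -> R) : R := / (2 * PI) * RInt f (- PI) PI.

Lemma two_PI_pos : 0 < 2 * PI.
Proof. generalize PI_RGT_0; lra. Qed.

Lemma is_mean_unique (f : R -> R) (m : R) : is_mean f m -> mean f = m.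
Proof.
  intros H; unfold mean; rewrite (is_RInt_unique _ _ _ _ H).
  field; generalize PI_RGT_0; lra.
Qed.

Lemma is_mean_ext (f g : R -> R) (m : R) :
  (forall t, f t = g t) -> is_mean f m -> is_mean g m.
Proof. intros E; apply is_RInt_ext; intros t _; apply E. Qed.

Lemma is_mean_eq (f : R -> R) (a b : R) : a = b -> is_mean f a -> is_mean f b.
Proof. now intros ->. Qed.

Lemma is_mean_plus (f g : R -> R) (a b : R) :
  is_mean f a -> is_mean g b -> is_mean (fun t => f t + g t) (a + b).
Proof.
  intros Hf Hg; unfold is_mean; rewrite Rmult_plus_distr_l.
  exact (is_RInt_plus f g _ _ _ _ Hf Hg).
Qed.

Lemma is_mean_scal (c : R) (f : R -> R) (a : R) :
  is_mean f a -> is_mean (fun t => c * f t) (c * a).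
Proof.
  intros Hf; unfold is_mean; replace (2 * PI * (c * a)) with (c * (2 * PI * a)) by ring.
  exact (is_RInt_scal f _ _ c _ Hf).
Qed.

Lemma is_mean_minus (f g : R -> R) (a b : R) :
  is_mean f a -> is_mean g b -> is_mean (fun t => f t - g t) (a - b).
Proof.
  intros Hf Hg.
  apply (is_mean_ext (fun t => f t + -1 * g t)); [intros; ring|].
  apply (is_mean_eq _ (a + -1 * b)); [ring|].
  now apply is_mean_plus; [|apply is_mean_scal].
Qed.

Lemma is_mean_const (c : R) : is_mean (fun _ => c) c.
Proof.
  unfold is_mean; replace (2 * PI * c) with (scal (PI - - PI) c).
  - apply (is_RInt_const (V := R_NormedModule)).
  - unfold scal; simpl; unfold mult; simpl; ring.
Qed.

Lemma is_mean_le (f g : R -> R) (a b : R) :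
  is_mean f a -> is_mean g b ->
  (forall t, - PI <= t <= PI -> f t <= g t) -> a <= b.
Proof.
  intros Hf Hg H; apply (Rmult_le_reg_l (2 * PI)); [apply two_PI_pos|].
  apply (is_RInt_le f g (- PI) PI); auto.
  - generalize PI_RGT_0; lra.
  - intros t Ht; apply H; lra.
Qed.

Lemma is_mean_continuous (f : R -> R) :
  (forall t, continuous f t) -> is_mean f (mean f).
Proof.
  intros H; unfold is_mean, mean.
  rewrite <- Rmult_assoc, Rinv_r, Rmult_1_l by (generalize PI_RGT_0; lra).
  apply (RInt_correct (V := R_CompleteNormedModule)).
  apply (ex_RInt_continuous (V := R_CompleteNormedModule)); intros; apply H.
Qed.

Lemma is_mean_derive (f df : R -> R) :
  (forall t, is_derive f t (df t)) -> (forall t, continuous df t) ->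
  f PI = f (- PI) -> is_mean df 0.
Proof.
  intros Hd Hc E; unfold is_mean.
  replace (2 * PI * 0) with (minus (f PI) (f (- PI))).
  - apply (is_RInt_derive (V := R_CompleteNormedModule)); auto.
  - rewrite E; unfold minus, plus, opp; simpl; ring.
Qed.

Lemma continuous_Rmult (f g : R -> R) (t : R) :
  continuous f t -> continuous g t -> continuous (fun x => f x * g x) t.
Proof. apply (continuous_mult (K := R_AbsRing)). Qed.

Lemma continuous_Rplus (f g : R -> R) (t : R) :
  continuous f t -> continuous g t -> continuous (fun x => f x + g x) t.
Proof. apply (continuous_plus (V := R_NormedModule)). Qed.

Lemma continuous_derivable (f : R -> R) (t : R) : ex_derive f t -> continuous f t.
Proof. apply (ex_derive_continuous (V := R_NormedModule)). Qed.

Lemma cos_at_PI (j : nat) : cos (INR j * PI) = cos (INR j * - PI).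
Proof. rewrite Ropp_mult_distr_r_reverse, cos_neg; reflexivity. Qed.

Lemma sin_at_PI (j : nat) : sin (INR j * PI) = sin (INR j * - PI).
Proof.
  rewrite <- (sin_period (INR j * - PI) j); f_equal; ring.
Qed.

Lemma is_mean_trig (a b : R) (j : nat) : (1 <= j)%nat ->
  is_mean (fun t => a * cos (INR j * t) + b * sin (INR j * t)) 0.
Proof.
  intros Hj; assert (0 < INR j) by (apply lt_0_INR; lia).
  apply (is_mean_derive (fun t => (a * sin (INR j * t) - b * cos (INR j * t)) / INR j)).
  - intros t; auto_derive; [easy|]; field; lra.
  - intros t; apply continuous_derivable; auto_derive; easy.
  - now rewrite cos_at_PI, sin_at_PI.
Qed.

(** Being polynomial in the two components, the squared modulus is within reach of [ring] and [nra],
    and no square roots arise. *)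
Definition nsq (z : C) : R := fst z ^ 2 + snd z ^ 2.

Lemma nsq_Cmod (z : C) : Cmod z ^ 2 = nsq z.
Proof. unfold Cmod; apply pow2_sqrt; unfold nsq; nra. Qed.

Lemma nsq_pos (z : C) : 0 <= nsq z.
Proof. unfold nsq; nra. Qed.

Lemma nsq_mult (y z : C) : nsq (y * z) = nsq y * nsq z.
Proof. unfold nsq; destruct y, z; simpl; ring. Qed.

Lemma nsq_conj (z : C) : nsq (Cconj z) = nsq z.
Proof. unfold nsq; destruct z; simpl; ring. Qed.

Lemma nsq_eit (t : R) : nsq (eit t) = 1.
Proof. unfold nsq, eit; generalize (sin2_cos2 t); unfold Rsqr; simpl; intros H; nra. Qed.

Lemma nsq_pow (z : C) (n : nat) : nsq (Cpow z n) = nsq z ^ n.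
Proof.
  induction n as [|n IH]; simpl; [unfold nsq; simpl; ring|].
  now rewrite nsq_mult, IH.
Qed.

(** Young's inequality in each component. The unequal split keeps the first factor at 1 + 1/m, which
    can be iterated m times at bounded cost. *)
Lemma nsq_plus_le (m : R) (y z : C) : 0 < m ->
  nsq (y + z) <= (1 + / m) * nsq y + (1 + m) * nsq z.
Proof.
  intros Hm; unfold nsq; destruct y as [a b], z as [c d]; simpl.
  assert (E : forall x y, 2 * x * y <= / m * x ^ 2 + m * y ^ 2).
  { intros x y. assert (0 <= / m * (x - m * y) ^ 2).
    { apply Rmult_le_pos; [left; now apply Rinv_0_lt_compat|apply pow2_ge_0]. }
    replace (/ m * (x - m * y) ^ 2) with (/ m * x ^ 2 + m * y ^ 2 - 2 * x * y) in H
      by (field; lra). lra. }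
  generalize (E a c) (E b d); simpl; nra.
Qed.

Lemma eit_pow (t : R) (n : nat) : Cpow (eit t) n = eit (INR n * t).
Proof.
  induction n as [|n IH].
  - simpl; unfold eit; now rewrite Rmult_0_l, cos_0, sin_0.
  - rewrite Cpow_S, IH, S_INR, Rmult_plus_distr_r, Rmult_1_l.
    unfold eit, Cmult; simpl; rewrite cos_plus, sin_plus; f_equal; ring.
Qed.

(** * Polynomials as coefficient lists *)

(** Horner's scheme, constant coefficient first. Trailing zeros are allowed, so the length minus one
    only bounds the degree. *)
Fixpoint ev (p : list C) (z : C) : C :=
  match p with nil => RtoC 0 | a :: p => Cplus a (Cmult z (ev p z)) end.

Fixpoint padd (p q : list C) : list C :=
  match p, q with
  | nil, _ => q
  | _, nil => p
  | a :: p, b :: q => Cplus a b :: padd p q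
  end.

Definition pscal (c : C) (p : list C) : list C := map (Cmult c) p.

Fixpoint pmul (p q : list C) : list C :=
  match p with nil => nil | a :: p => padd (pscal a q) (RtoC 0 :: pmul p q) end.

Definition coef (p : list C) (n : nat) : C := nth n p (RtoC 0).

Lemma ev_padd (p q : list C) (z : C) : ev (padd p q) z = Cplus (ev p z) (ev q z).
Proof.
  revert q; induction p as [|a p IH]; intros [|b q]; simpl; try ring.
  rewrite IH; ring.
Qed.

Lemma ev_pscal (c : C) (p : list C) (z : C) : ev (pscal c p) z = Cmult c (ev p z).
Proof. induction p as [|a p IH]; simpl; [ring|]; rewrite IH; ring. Qed.

Lemma ev_pmul (p q : list C) (z : C) : ev (pmul p q) z = Cmult (ev p z) (ev q z).
Proof.
  induction p as [|a p IH]; [simpl; ring|].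
  simpl pmul; rewrite ev_padd, ev_pscal; simpl; rewrite IH; ring.
Qed.

Lemma ev_app (p q : list C) (z : C) :
  ev (p ++ q) z = Cplus (ev p z) (Cmult (Cpow z (length p)) (ev q z)).
Proof. induction p as [|a p IH]; simpl; [ring|]; rewrite IH; ring. Qed.

Lemma coef_nil (n : nat) : coef nil n = RtoC 0.
Proof. now destruct n. Qed.

Lemma coef_padd (p q : list C) (n : nat) :
  coef (padd p q) n = Cplus (coef p n) (coef q n).
Proof.
  revert q n; induction p as [|a p IH]; intros [|b q] n; simpl;
    rewrite ?coef_nil; try ring.
  destruct n; [reflexivity|exact (IH q n)].
Qed.

Lemma coef_pscal (c : C) (p : list C) (n : nat) :
  coef (pscal c p) n = Cmult c (coef p n).
Proof.
  revert n; induction p as [|a p IH]; intros n; simpl.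
  - rewrite !coef_nil; ring.
  - destruct n; [reflexivity|exact (IH n)].
Qed.

Lemma coef_pmul_0 (p q : list C) : coef (pmul p q) 0 = Cmult (coef p 0) (coef q 0).
Proof.
  destruct p as [|a p]; [rewrite !coef_nil; ring|].
  simpl pmul; rewrite coef_padd, coef_pscal; unfold coef; simpl; ring.
Qed.

Lemma sum_f_R0_head (f : nat -> R) (n : nat) :
  sum_f_R0 f (S n) = f 0%nat + sum_f_R0 (fun i => f (S i)) n.
Proof. apply (decomp_sum f (S n)); lia. Qed.

Lemma Cmod_coef_pmul_le (p q : list C) (n : nat) :
  Cmod (coef (pmul p q) n)
  <= sum_f_R0 (fun i => Cmod (coef p i) * Cmod (coef q (n - i))) n.
Proof.
  revert n; induction p as [|a p IH]; intros n.
  - simpl pmul; rewrite coef_nil, Cmod_0.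
    apply cond_pos_sum; intros i; rewrite coef_nil, Cmod_0; lra.
  - simpl pmul; rewrite coef_padd, coef_pscal.
    eapply Rle_trans; [apply Cmod_triangle|]; rewrite Cmod_mult.
    destruct n as [|n].
    + unfold coef; simpl; rewrite Cmod_0; lra.
    + rewrite sum_f_R0_head; apply Rplus_le_compat; [apply Rle_refl|].
      exact (IH n).
Qed.

Lemma continuous_ev (p : list C) (t : R) :
  continuous (fun t => fst (ev p (eit t))) t /\
  continuous (fun t => snd (ev p (eit t))) t.
Proof.
  assert (Hc : continuous cos t) by (apply continuous_derivable; auto_derive; easy).
  assert (Hs : continuous sin t) by (apply continuous_derivable; auto_derive; easy).
  assert (Hk : forall c : R, continuous (fun _ : R => c) t)
    by (intros c; apply continuous_const).
  induction p as [|a p [IH1 IH2]]; simpl; [split; apply Hk|].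
  split; apply continuous_Rplus; try apply Hk.
  - apply (continuous_minus (V := R_NormedModule)); now apply continuous_Rmult.
  - apply continuous_Rplus; now apply continuous_Rmult.
Qed.

Lemma continuous_nsq_ev (p : list C) (t : R) :
  continuous (fun t => nsq (ev p (eit t))) t.
Proof.
  destruct (continuous_ev p t) as [H1 H2]; unfold nsq.
  apply continuous_Rplus; simpl;
    repeat (apply continuous_Rmult; auto); apply continuous_const.
Qed.

(** Only positive frequencies occur in c z^m p(z). The induction moves one power of z at a time from
    the list into the shift [m], which is therefore general. *)
Lemma is_mean_shifted (p : list C) (c : C) (m : nat) : (1 <= m)%nat ->
  is_mean (fun t => Re (Cmult (Cmult c (eit (INR m * t))) (ev p (eit t)))) 0.
Proof.
  revert m; induction p as [|a p IH]; intros m Hm.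
  - apply (is_mean_ext (fun _ => 0)); [|apply is_mean_const].
    intros t; simpl; ring.
  - rewrite <- (Rplus_0_l 0).
    apply (is_mean_ext (fun t => (Re (Cmult c a) * cos (INR m * t) + - Im (Cmult c a) * sin (INR m * t))
       + Re (Cmult (Cmult c (eit (INR (S m) * t))) (ev p (eit t))))).
    + intros t; rewrite S_INR, Rmult_plus_distr_r, Rmult_1_l.
      unfold eit; rewrite cos_plus, sin_plus; simpl; ring.
    + apply is_mean_plus; [now apply is_mean_trig|apply IH; lia].
Qed.

Fixpoint sumsq (p : list C) : R :=
  match p with nil => 0 | a :: p => nsq a + sumsq p end.

Lemma sumsq_pos (p : list C) : 0 <= sumsq p.
Proof. induction p as [|a p IH]; simpl; [lra|]; generalize (nsq_pos a); lra. Qed.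

(** On the circle |a + z q|^2 = |a|^2 + |q|^2 + 2 Re (conj(a) z q), and the cross term has mean 0 by
    [is_mean_shifted]. *)
Lemma parseval (p : list C) : is_mean (fun t => nsq (ev p (eit t))) (sumsq p).
Proof.
  induction p as [|a p IH]; simpl.
  - apply (is_mean_ext (fun _ => 0)); [|apply is_mean_const].
    intros t; unfold nsq; simpl; ring.
  - apply (is_mean_eq _ ((nsq a + sumsq p) + 2 * 0)); [ring|].
    apply (is_mean_ext (fun t => (nsq a + nsq (ev p (eit t)))
       + 2 * Re (Cmult (Cmult (Cconj a) (eit (INR 1 * t))) (ev p (eit t))))).
    + intros t; rewrite Rmult_1_l.
      replace (nsq (ev p (eit t))) with (nsq (eit t) * nsq (ev p (eit t)))
        by (rewrite nsq_eit; ring).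
      unfold nsq; simpl; ring.
    + apply is_mean_plus; [apply is_mean_plus; [apply is_mean_const|exact IH]|].
      apply is_mean_scal, is_mean_shifted; lia.
Qed.

(** The reversed polynomial of orthogonal polynomial theory: conj(z) = 1/z on the circle. The extra
    factor z on the left avoids the exponent [length p - 1]. *)
Lemma ev_rev_conj (p : list C) (z : C) : nsq z = 1 ->
  Cmult z (ev (rev (map Cconj p)) z) = Cmult (Cpow z (length p)) (Cconj (ev p z)).
Proof.
  intros Hz; assert (E : Cmult z (Cconj z) = RtoC 1).
  { unfold nsq in Hz; destruct z as [x y]; simpl in *; unfold Cmult, Cconj, RtoC; simpl.
    f_equal; lra. }
  induction p as [|a p IH]; [simpl; unfold Cconj; simpl; rewrite Ropp_0; fold (RtoC 0); ring|].
  simpl; rewrite ev_app, length_rev, length_map, Cmult_plus_distr_l, IH; simpl.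
  rewrite Cplus_conj, Cmult_conj.
  transitivity (Cplus (Cmult (Cpow z (length p)) (Cmult z (Cconj a)))
     (Cmult (Cmult z (Cconj z)) (Cmult (Cpow z (length p)) (Cconj (ev p z))))); [|ring].
  rewrite E; ring.
Qed.

(** Reversal keeps the modulus on the circle and exchanges leading and constant coefficients, so
    monic polynomials and those with P(0) = 1 give the same extremal problem. *)
Lemma nsq_ev_rev_conj (p : list C) (t : R) :
  nsq (ev (rev (map Cconj p)) (eit t)) = nsq (ev p (eit t)).
Proof.
  generalize (f_equal nsq (ev_rev_conj p (eit t) (nsq_eit t))).
  rewrite !nsq_mult, nsq_pow, nsq_eit, pow1, nsq_conj; lra.
Qed.

Lemma poly_eval_head (a : nat -> C) (n : nat) (z : C) :
  poly_eval a (S n) z = Cplus (a 0%nat) (Cmult z (poly_eval (fun j => a (S j)) n z)).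
Proof.
  unfold poly_eval; induction n as [|n IH].
  - rewrite sum_Sn, !sum_O; unfold plus; simpl; ring.
  - rewrite sum_Sn, IH, sum_Sn; unfold plus; simpl; ring.
Qed.

Lemma ev_map_seq (a : nat -> C) (s n : nat) (z : C) :
  ev (map a (seq s (S n))) z = poly_eval (fun j => a (s + j)%nat) n z.
Proof.
  revert s; induction n as [|n IH]; intros s.
  - unfold poly_eval; rewrite sum_O; simpl; rewrite Nat.add_0_r; ring.
  - rewrite poly_eval_head, Nat.add_0_r.
    change (ev (map a (seq s (S (S n)))) z)
      with (Cplus (a s) (Cmult z (ev (map a (seq (S s) (S n))) z))).
    rewrite IH; do 2 f_equal. unfold poly_eval; apply sum_n_ext; intros j.
    now replace (S s + j)%nat with (s + S j)%nat by lia.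
Qed.

Lemma poly_eval_coef (l : list C) (n : nat) (z : C) : length l = S n ->
  poly_eval (coef l) n z = ev l z.
Proof.
  revert n; induction l as [|a l IH]; intros n Hl; [easy|].
  destruct n as [|n].
  - destruct l; [|easy]. unfold poly_eval; rewrite sum_O; unfold coef; simpl; ring.
  - rewrite poly_eval_head; unfold coef at 1; simpl; f_equal; f_equal.
    apply (IH n); now injection Hl.
Qed.

(** * A weighted convolution algebra *)

Lemma sum_f_R0_rev (f : nat -> R) (n : nat) :
  sum_f_R0 (fun i => f (n - i)%nat) n = sum_f_R0 f n.
Proof.
  induction n as [|n IH]; [reflexivity|].
  rewrite sum_f_R0_head; simpl (S n - 0)%nat.
  change (sum_f_R0 (fun i => f (S n - S i)%nat) n)
    with (sum_f_R0 (fun i => f (n - i)%nat) n).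
  rewrite IH; simpl; ring.
Qed.

Lemma sum_f_R0_scal (c : R) (f : nat -> R) (n : nat) :
  sum_f_R0 (fun i => c * f i) n = c * sum_f_R0 f n.
Proof. induction n as [|n IH]; simpl; [ring|]; rewrite IH; ring. Qed.

Lemma cauchy_schwarz_sum (u v : nat -> R) (n : nat) :
  sum_f_R0 (fun i => u i * v i) n ^ 2
  <= sum_f_R0 (fun i => u i ^ 2) n * sum_f_R0 (fun i => v i ^ 2) n.
Proof.
  induction n as [|n IH]; [simpl; nra|].
  rewrite !tech5.
  set (P := sum_f_R0 (fun i => u i * v i) n) in *.
  set (a := sum_f_R0 (fun i => u i ^ 2) n) in *.
  set (b := sum_f_R0 (fun i => v i ^ 2) n) in *.
  assert (Ha : 0 <= a) by (apply cond_pos_sum; intros; apply pow2_ge_0).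
  assert (Hb : 0 <= b) by (apply cond_pos_sum; intros; apply pow2_ge_0).
  generalize (u (S n)) (v (S n)); intros x y.
  (* Compare squares: 4 P^2 x^2 y^2 <= 4 a b x^2 y^2 <= (a y^2 + b x^2)^2. *)
  assert (H : 2 * P * (x * y) <= a * y ^ 2 + b * x ^ 2).
  { apply Rle_trans with (1 := Rle_abs _).
    assert (0 <= a * y ^ 2 + b * x ^ 2)
      by (apply Rplus_le_le_0_compat; apply Rmult_le_pos; auto; apply pow2_ge_0).
    rewrite <- (Rabs_pos_eq (a * y ^ 2 + b * x ^ 2)) by easy.
    apply Rsqr_le_abs_0; unfold Rsqr.
    assert (P ^ 2 * (x * y) ^ 2 <= a * b * (x * y) ^ 2)
      by (apply Rmult_le_compat_r; [apply pow2_ge_0|easy]).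
    generalize (pow2_ge_0 (a * y ^ 2 - b * x ^ 2)); nra. }
  nra.
Qed.

(** Telescoping with 1/(m+1)^2 <= 1/m - 1/(m+1); the subtracted term on the right is what makes the
    induction close. *)
Lemma sum_inv_sq_le (n : nat) : sum_f_R0 (fun i => (/ INR (S i)) ^ 2) n <= 2 - / INR (S n).
Proof.
  induction n as [|n IH]; [simpl; lra|].
  rewrite tech5; apply Rle_trans with (2 - / INR (S n) + (/ INR (S (S n))) ^ 2); [lra|].
  rewrite !S_INR; generalize (pos_INR n); generalize (INR n); intros x Hx.
  cut (0 <= / (x + 1) - / (x + 1 + 1) - (/ (x + 1 + 1)) ^ 2); [lra|].
  replace (/ (x + 1) - / (x + 1 + 1) - (/ (x + 1 + 1)) ^ 2)
    with (/ ((x + 1) * (x + 2) ^ 2)) by (field; lra).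
  left; apply Rinv_0_lt_compat; apply Rmult_lt_0_compat; [lra|apply pow_lt; lra].
Qed.

Definition wt (k j : nat) : R := INR (S j) ^ (2 * k).

Lemma wt_pos (k j : nat) : 0 < wt k j.
Proof. apply pow_lt, lt_0_INR; lia. Qed.

(** Put a = 1/(i+1) and b = 1/(n-i+1). As n+1 < 1/a + 1/b, the ratio r = (n+1) a b is at most a + b,
    whence r^2 <= 2 (a^2 + b^2) <= 4. Of the k factors r^2, one is bounded by 2 (a^2 + b^2) and the
    others by 4. *)
Lemma wt_ratio_le (k n i : nat) : (1 <= k)%nat -> (i <= n)%nat ->
  wt k n * (/ (INR (S i) ^ k * INR (S (n - i)) ^ k)) ^ 2
  <= 4 ^ k / 2 * ((/ INR (S i)) ^ 2 + (/ INR (S (n - i))) ^ 2).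
Proof.
  intros Hk Hi; unfold wt.
  assert (E : INR (S n) = INR (S i) + INR (S (n - i)) - 1).
  { rewrite <- plus_INR; replace (S i + S (n - i))%nat with (S (S n)) by lia.
    rewrite (S_INR (S n)); ring. }
  assert (Hx : 1 <= INR (S i)) by (rewrite S_INR; generalize (pos_INR i); lra).
  assert (Hy : 1 <= INR (S (n - i))) by (rewrite S_INR; generalize (pos_INR (n - i)); lra).
  revert E Hx Hy; generalize (INR (S i)) (INR (S (n - i))) (INR (S n)).
  intros x y z E Hx Hy.
  set (a := / x); set (b := / y); set (r := z * (a * b)).
  assert (Ha : 0 < a <= 1).
  { split; [apply Rinv_0_lt_compat; lra|]. unfold a; rewrite <- Rinv_1; apply Rinv_le_contravar; lra. }
  assert (Hb : 0 < b <= 1).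
  { split; [apply Rinv_0_lt_compat; lra|]. unfold b; rewrite <- Rinv_1; apply Rinv_le_contravar; lra. }
  assert (Hr : 0 <= r <= a + b).
  { split; [apply Rmult_le_pos; [lra|nra]|].
    replace (a + b) with ((x + y) * (a * b)) by (unfold a, b; field; lra).
    apply Rmult_le_compat_r; [nra|lra]. }
  replace (z ^ (2 * k) * (/ (x ^ k * y ^ k)) ^ 2) with ((r ^ 2) ^ k).
  2:{ rewrite <- pow_mult; unfold r; rewrite Rpow_mult_distr; f_equal.
      rewrite !(Nat.mul_comm 2 k), !pow_mult; f_equal.
      rewrite <- Rpow_mult_distr, <- pow_inv; f_equal; unfold a, b; field; lra. }
  assert (H2 : r ^ 2 <= 2 * (a ^ 2 + b ^ 2)) by (generalize (pow2_ge_0 (a - b)); nra).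
  assert (H4 : 2 * (a ^ 2 + b ^ 2) <= 4) by nra.
  destruct k as [|k]; [lia|].
  change ((r ^ 2) ^ S k) with (r ^ 2 * (r ^ 2) ^ k).
  replace (4 ^ S k / 2 * (a ^ 2 + b ^ 2)) with (2 * (a ^ 2 + b ^ 2) * 4 ^ k) by (simpl; field).
  apply Rmult_le_compat; try apply pow2_ge_0; auto.
  - apply pow_le, pow2_ge_0.
  - apply pow_incr; split; [apply pow2_ge_0|lra].
Qed.

(** Cauchy-Schwarz after moving the square roots of the weights from [u] to [v]. By [wt_ratio_le]
    the sum of [u i ^ 2] times [wt k n] is at most 4^k/2 times two sums of inverse squares, each at
    most 2. *)
Lemma wt_conv_le (k : nat) (x y : nat -> R) (n : nat) : (1 <= k)%nat ->
  wt k n * sum_f_R0 (fun i => x i * y (n - i)%nat) n ^ 2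
  <= 2 * 4 ^ k * sum_f_R0 (fun i => (wt k i * x i ^ 2) * (wt k (n - i) * y (n - i)%nat ^ 2)) n.
Proof.
  intros Hk.
  set (u := fun i => / (INR (S i) ^ k * INR (S (n - i)) ^ k)).
  set (v := fun i => (INR (S i) ^ k * INR (S (n - i)) ^ k) * (x i * y (n - i)%nat)).
  assert (Hw : forall i, 0 < INR (S i) ^ k) by (intros; apply pow_lt, lt_0_INR; lia).
  rewrite (sum_eq (fun i => x i * y (n - i)%nat) (fun i => u i * v i)).
  2:{ intros i _; unfold u, v; field; split; apply Rgt_not_eq, Hw. }
  rewrite (sum_eq (fun i => (wt k i * x i ^ 2) * (wt k (n - i) * y (n - i)%nat ^ 2)) (fun i => v i ^ 2)).
  2:{ intros i _; unfold v, wt; rewrite !(Nat.mul_comm 2 k), !pow_mult; ring. }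
  eapply Rle_trans; [apply Rmult_le_compat_l; [left; apply wt_pos|apply cauchy_schwarz_sum]|].
  rewrite <- Rmult_assoc; apply Rmult_le_compat_r; [apply cond_pos_sum; intros; apply pow2_ge_0|].
  rewrite <- sum_f_R0_scal.
  eapply Rle_trans; [apply sum_Rle; intros i Hi; apply (wt_ratio_le k n i Hk Hi)|].
  rewrite sum_f_R0_scal, sum_plus, (sum_f_R0_rev (fun i => (/ INR (S i)) ^ 2)).
  assert (H := sum_inv_sq_le n).
  assert (0 < / INR (S n)) by (apply Rinv_0_lt_compat, lt_0_INR; lia).
  assert (0 < 4 ^ k) by (apply pow_lt; lra). nra.
Qed.

(** The left side sums over the triangle i + j <= M, the right side over the whole square. The
    induction splits off the terms with [x 0]. *)
Lemma sum_conv_le (x y : nat -> R) (M : nat) :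
  (forall i, 0 <= x i) -> (forall i, 0 <= y i) ->
  sum_f_R0 (fun n => sum_f_R0 (fun i => x i * y (n - i)%nat) n) M
  <= sum_f_R0 x M * sum_f_R0 y M.
Proof.
  intros Hx Hy; revert x Hx; induction M as [|M IH]; intros x Hx; [simpl; lra|].
  rewrite sum_f_R0_head.
  rewrite (sum_eq _ (fun n => x 0%nat * y (S n) + sum_f_R0 (fun i => x (S i) * y (n - i)%nat) n) M).
  2:{ intros n _; apply sum_f_R0_head. }
  rewrite sum_plus, sum_f_R0_scal.
  specialize (IH (fun i => x (S i)) (fun i => Hx (S i))); simpl in IH.
  rewrite (sum_f_R0_head x), (sum_f_R0_head y M).
  assert (HY : sum_f_R0 y M <= y 0%nat + sum_f_R0 (fun i => y (S i)) M).
  { rewrite <- sum_f_R0_head; simpl; generalize (Hy (S M)); lra. }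
  assert (HX : 0 <= sum_f_R0 (fun i => x (S i)) M) by (apply cond_pos_sum; intros; apply Hx).
  simpl (sum_f_R0 _ 0). simpl (0 - 0)%nat.
  assert (sum_f_R0 (fun i => x (S i)) M * sum_f_R0 y M
     <= sum_f_R0 (fun i => x (S i)) M * (y 0%nat + sum_f_R0 (fun i => y (S i)) M))
    by now apply Rmult_le_compat_l.
  lra.
Qed.

(** The square of the weighted l^2 norm, cut off at [M]. Bounds are stated for all [M], which stands
    for finiteness of the full norm. *)
Definition wnorm (k : nat) (p : list C) (M : nat) : R :=
  sum_f_R0 (fun j => wt k j * nsq (coef p j)) M.

Lemma wnorm_pos (k : nat) (p : list C) (M : nat) : 0 <= wnorm k p M.
Proof.
  apply cond_pos_sum; intros; apply Rmult_le_pos; [left; apply wt_pos|apply nsq_pos].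
Qed.

Lemma wnorm_pmul (k : nat) (p q : list C) (M : nat) : (1 <= k)%nat ->
  wnorm k (pmul p q) M <= 2 * 4 ^ k * (wnorm k p M * wnorm k q M).
Proof.
  intros Hk; unfold wnorm.
  eapply Rle_trans.
  - apply sum_Rle; intros n _.
    eapply Rle_trans.
    + apply Rmult_le_compat_l; [left; apply wt_pos|]. rewrite <- nsq_Cmod.
      apply pow_incr; split; [apply Cmod_ge_0|apply Cmod_coef_pmul_le].
    + apply (wt_conv_le k (fun i => Cmod (coef p i)) (fun i => Cmod (coef q i)) n Hk).
  - rewrite sum_f_R0_scal; apply Rmult_le_compat_l.
    + assert (0 < 4 ^ k) by (apply pow_lt; lra); lra.
    + rewrite (sum_eq (fun j => wt k j * nsq (coef p j)) (fun j => wt k j * Cmod (coef p j) ^ 2))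
        by (intros; now rewrite nsq_Cmod).
      rewrite (sum_eq (fun j => wt k j * nsq (coef q j)) (fun j => wt k j * Cmod (coef q j) ^ 2))
        by (intros; now rewrite nsq_Cmod).
      apply (sum_conv_le (fun i => wt k i * Cmod (coef p i) ^ 2) (fun i => wt k i * Cmod (coef q i) ^ 2));
        intros i; apply Rmult_le_pos; try apply pow2_ge_0; left; apply wt_pos.
Qed.

(** * Polynomial approximation of the exponential *)

(** The list form of (1 + c F)^i; with c = 1/m or c = -1/m and i = m it approximates exp F or
    exp(-F). *)
Fixpoint epow (F : list C) (c : R) (i : nat) : list C :=
  match i with
  | O => RtoC 1 :: nil
  | S i => padd (epow F c i) (pscal (RtoC c) (pmul F (epow F c i)))
  end.

Lemma ev_epow (F : list C) (c : R) (i : nat) (z : C) :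
  ev (epow F c i) z = Cpow (Cplus (RtoC 1) (Cmult (RtoC c) (ev F z))) i.
Proof.
  induction i as [|i IH]; simpl; [ring|].
  rewrite ev_padd, ev_pscal, ev_pmul, IH; ring.
Qed.

Lemma coef_epow_0 (F : list C) (c : R) (i : nat) :
  coef F 0 = RtoC 0 -> coef (epow F c i) 0 = RtoC 1.
Proof.
  intros HF; induction i as [|i IH]; simpl; [reflexivity|].
  rewrite coef_padd, coef_pscal, coef_pmul_0, IH, HF; ring.
Qed.

Lemma pow_1_plus_le_exp (x : R) (n : nat) : 0 <= 1 + x -> (1 + x) ^ n <= exp (INR n * x).
Proof.
  intros Hx; induction n as [|n IH]; [simpl; rewrite Rmult_0_l, exp_0; lra|].
  rewrite S_INR, Rmult_plus_distr_r, Rmult_1_l, exp_plus; simpl; rewrite Rmult_comm.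
  apply Rmult_le_compat; auto; [now apply pow_le|apply exp_ineq1_le].
Qed.

(** [nsq_plus_le] with parameter m: the part c F P gets the coefficient (1+m)/m^2 <= 2/m, so one
    multiplication by 1 + c F costs only a factor 1 + O(1/m). *)
Lemma wnorm_epow_step (k : nat) (F P : list C) (c m A : R) (M : nat) :
  (1 <= k)%nat -> 1 <= m -> c ^ 2 = / m ^ 2 -> wnorm k F M <= A ->
  wnorm k (padd P (pscal (RtoC c) (pmul F P))) M
  <= (1 + (1 + 4 * 4 ^ k * A) / m) * wnorm k P M.
Proof.
  intros Hk Hm Hc HA.
  apply Rle_trans with ((1 + / m) * wnorm k P M + (1 + m) * (/ m ^ 2 * wnorm k (pmul F P) M)).
  - unfold wnorm; rewrite <- !sum_f_R0_scal, <- sum_plus.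
    apply sum_Rle; intros j _; rewrite coef_padd, coef_pscal.
    eapply Rle_trans; [apply Rmult_le_compat_l; [left; apply wt_pos|apply (nsq_plus_le m); lra]|].
    rewrite nsq_mult; replace (nsq (RtoC c)) with (/ m ^ 2)
      by (rewrite <- Hc; unfold nsq; simpl; ring).
    right; ring.
  - assert (H1 := wnorm_pmul k F P M Hk).
    assert (HP := wnorm_pos k P M).
    assert (H4 : 0 < 4 ^ k) by (apply pow_lt; lra).
    assert (H2 : wnorm k (pmul F P) M <= 2 * 4 ^ k * (A * wnorm k P M)).
    { eapply Rle_trans; [exact H1|]. apply Rmult_le_compat_l; [lra|]. now apply Rmult_le_compat_r. }
    assert (H3 : (1 + m) * / m ^ 2 <= 2 / m).
    { replace (2 / m) with ((m + m) * / m ^ 2) by (field; lra).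
      apply Rmult_le_compat_r; [|lra]. left; apply Rinv_0_lt_compat, pow_lt; lra. }
    assert ((1 + m) * (/ m ^ 2 * wnorm k (pmul F P) M) <= 2 / m * (2 * 4 ^ k * (A * wnorm k P M))).
    { rewrite <- Rmult_assoc; apply Rmult_le_compat; auto; [|apply wnorm_pos].
      apply Rmult_le_pos; [lra|]. left; apply Rinv_0_lt_compat, pow_lt; lra. }
    replace ((1 + (1 + 4 * 4 ^ k * A) / m) * wnorm k P M)
      with ((1 + / m) * wnorm k P M + 2 / m * (2 * 4 ^ k * (A * wnorm k P M))) by (field; lra).
    lra.
Qed.

Lemma wnorm_one (k M : nat) : wnorm k (RtoC 1 :: nil) M = 1.
Proof.
  induction M as [|M IH]; unfold wnorm in *.
  - simpl sum_f_R0; unfold wt, coef, nsq; simpl (INR 1); rewrite pow1; simpl; ring.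
  - rewrite tech5, IH; unfold coef; simpl; destruct M; unfold nsq; simpl; ring.
Qed.

(** Iterating the step m times gives (1 + B/m)^m <= exp B, a bound independent of [m]. *)
Lemma wnorm_epow (k : nat) (F : list C) (c A : R) (m M : nat) :
  (1 <= k)%nat -> (1 <= m)%nat -> c ^ 2 = / INR m ^ 2 -> wnorm k F M <= A ->
  wnorm k (epow F c m) M <= exp (1 + 4 * 4 ^ k * A).
Proof.
  intros Hk Hm Hc HA.
  assert (Hm1 : 1 <= INR m) by (apply (le_INR 1); lia).
  assert (H4 : 0 < 4 ^ k) by (apply pow_lt; lra).
  assert (HA0 : 0 <= A) by (eapply Rle_trans; [apply wnorm_pos|exact HA]).
  set (B := 1 + 4 * 4 ^ k * A).
  assert (HB : 0 <= B) by (unfold B; apply Rplus_le_le_0_compat; [lra|]; apply Rmult_le_pos; lra).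
  assert (HBm : 0 <= B / INR m) by (apply Rdiv_le_0_compat; lra).
  assert (H : forall i, wnorm k (epow F c i) M <= (1 + B / INR m) ^ i).
  { induction i as [|i IH]; [simpl; rewrite wnorm_one; lra|].
    simpl epow; eapply Rle_trans; [apply (wnorm_epow_step k F _ c (INR m) A); auto|].
    fold B; simpl; apply Rmult_le_compat_l; [lra|exact IH]. }
  eapply Rle_trans; [apply H|].
  eapply Rle_trans; [apply pow_1_plus_le_exp; lra|].
  right; f_equal; field; lra.
Qed.

(** Induction through (1+u)^(n+1) - 1 = (1+u) ((1+u)^n - 1) + u. *)
Lemma Cmod_pow_1_plus_minus_1 (u : C) (n : nat) :
  Cmod (Cminus (Cpow (Cplus (RtoC 1) u) n) (RtoC 1)) <= (1 + Cmod u) ^ n - 1.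
Proof.
  induction n as [|n IH].
  - simpl; replace (Cminus (RtoC 1) (RtoC 1)) with (RtoC 0) by ring; rewrite Cmod_0; lra.
  - replace (Cminus (Cpow (Cplus (RtoC 1) u) (S n)) (RtoC 1))
      with (Cplus (Cmult (Cplus (RtoC 1) u) (Cminus (Cpow (Cplus (RtoC 1) u) n) (RtoC 1))) u)
      by (simpl; ring).
    eapply Rle_trans; [apply Cmod_triangle|]; rewrite Cmod_mult.
    assert (Cmod (Cplus (RtoC 1) u) <= 1 + Cmod u)
      by (eapply Rle_trans; [apply Cmod_triangle|rewrite Cmod_1; lra]).
    assert (Cmod (Cplus (RtoC 1) u) * Cmod (Cminus (Cpow (Cplus (RtoC 1) u) n) (RtoC 1))
      <= (1 + Cmod u) * ((1 + Cmod u) ^ n - 1))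
      by (apply Rmult_le_compat; auto; apply Cmod_ge_0).
    simpl; lra.
Qed.

(** With y = x - 2 x^2 one has (1+x)(1-y) = 1 + x^2 (1+2x) >= 1, and 1 - y <= exp(-y). *)
Lemma exp_sub_sq_le (x : R) : - (1 / 2) <= x -> exp (x - 2 * x ^ 2) <= 1 + x.
Proof.
  intros Hx.
  assert (H := exp_ineq1_le (- (x - 2 * x ^ 2))).
  assert (E : exp (x - 2 * x ^ 2) * exp (- (x - 2 * x ^ 2)) = 1)
    by (rewrite <- exp_plus, Rplus_opp_r, exp_0; reflexivity).
  assert (P := exp_pos (x - 2 * x ^ 2)).
  assert (1 <= (1 + x) * (1 + - (x - 2 * x ^ 2))).
  { replace ((1 + x) * (1 + - (x - 2 * x ^ 2))) with (1 + x ^ 2 * (1 + 2 * x)) by ring.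
    assert (0 <= x ^ 2 * (1 + 2 * x)) by (apply Rmult_le_pos; [apply pow2_ge_0|lra]); lra. }
  assert (1 <= (1 + x) * exp (- (x - 2 * x ^ 2))).
  { eapply Rle_trans; [eassumption|]. apply Rmult_le_compat_l; lra. }
  replace (1 + x) with ((1 + x) * exp (- (x - 2 * x ^ 2)) * exp (x - 2 * x ^ 2))
    by (rewrite Rmult_assoc, (Rmult_comm (exp (- _))), E; ring).
  rewrite <- (Rmult_1_l (exp (x - 2 * x ^ 2))) at 1.
  apply Rmult_le_compat_r; lra.
Qed.

Lemma exp_mono (x y : R) : x <= y -> exp x <= exp y.
Proof. intros [H| ->]; [left; now apply exp_increasing|apply Rle_refl]. Qed.

Lemma exp_pow (x : R) (n : nat) : exp x ^ n = exp (INR n * x).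
Proof.
  induction n as [|n IH]; [simpl; now rewrite Rmult_0_l, exp_0|].
  rewrite S_INR, Rmult_plus_distr_r, Rmult_1_l, exp_plus; simpl; rewrite IH; ring.
Qed.

(** |1 - w/m|^2 = 1 + x + |w|^2/m^2 with x = -2 Re(w)/m. The upper bound is 1 + t <= exp t; the
    lower one is [exp_sub_sq_le], where 2 x^2 <= 8 B/m^2. The size of [m] ensures x >= -1/2. *)
Lemma nsq_pow_bounds (w : C) (B : R) (m : nat) :
  nsq w <= B -> 4 * (1 + B) <= INR m ->
  exp (- 2 * fst w - 8 * B / INR m)
  <= nsq (Cpow (Cplus (RtoC 1) (Cmult (RtoC (- / INR m)) w)) m)
  <= exp (- 2 * fst w + B / INR m).
Proof.
  intros HB Hm.
  assert (H0 := nsq_pos w); assert (Hm0 : 0 < INR m) by lra.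
  set (h := / INR m); assert (Hh : 0 < h) by now apply Rinv_0_lt_compat.
  assert (Hmh : INR m * h = 1) by (apply Rinv_r; lra).
  rewrite nsq_pow.
  replace (nsq (Cplus (RtoC 1) (Cmult (RtoC (- h)) w)))
    with (1 + (- 2 * fst w * h + nsq w * h ^ 2))
    by (unfold nsq; destruct w; simpl; ring).
  assert (Ha : fst w ^ 2 <= B) by (unfold nsq in HB; generalize (pow2_ge_0 (snd w)); lra).
  assert (Hah : -(1/2) <= - 2 * fst w * h).
  { assert (4 * (1 + B) * h <= 1) by nra. assert (fst w <= 1 + B) by nra. nra. }
  split.
  - replace (- 2 * fst w - 8 * B / INR m) with (INR m * (- 2 * fst w * h - 8 * B * h ^ 2)).
    2:{ replace (8 * B / INR m) with (8 * B * h) by reflexivity.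
        transitivity (- 2 * fst w * (INR m * h) - 8 * B * h * (INR m * h)); [ring|]; rewrite Hmh; ring. }
    rewrite <- exp_pow; apply pow_incr; split; [left; apply exp_pos|].
    assert (H := exp_sub_sq_le _ Hah).
    eapply Rle_trans; [|eapply Rle_trans; [exact H|]].
    + apply exp_mono. assert (fst w ^ 2 * h ^ 2 <= B * h ^ 2)
        by (apply Rmult_le_compat_r; [apply pow2_ge_0|easy]). nra.
    + assert (0 <= nsq w * h ^ 2) by (apply Rmult_le_pos; [easy|apply pow2_ge_0]); lra.
  - eapply Rle_trans.
    + apply pow_1_plus_le_exp.
      assert (0 <= nsq w * h ^ 2) by (apply Rmult_le_pos; [easy|apply pow2_ge_0]); lra.
    + apply exp_mono.
      replace (INR m * (- 2 * fst w * h + nsq w * h ^ 2))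
        with (- 2 * fst w * (INR m * h) + nsq w * h * (INR m * h)) by ring.
      rewrite Hmh; unfold Rdiv; fold h. nra.
Qed.

Lemma ev_eit_bounded (F : list C) : exists B, 0 <= B /\ forall t, Cmod (ev F (eit t)) <= B.
Proof.
  induction F as [|a F [B [HB H]]].
  - exists 0; split; [lra|]; intros t; simpl; rewrite Cmod_0; lra.
  - exists (Cmod a + B); split; [generalize (Cmod_ge_0 a); lra|].
    intros t; simpl; eapply Rle_trans; [apply Cmod_triangle|].
    rewrite Cmod_mult; replace (Cmod (eit t)) with 1; [generalize (H t); lra|].
    unfold Cmod; change (1 = sqrt (nsq (eit t))); now rewrite nsq_eit, sqrt_1.
Qed.

(* [D] approximates exp(-F) and [Q] approximates exp F. *)
Lemma exp_polynomials (k : nat) (F : list C) (A eps : R) :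
  (1 <= k)%nat -> coef F 0 = RtoC 0 -> (forall M, wnorm k F M <= A) -> 0 < eps <= 1 ->
  exists D Q : list C,
    coef D 0 = RtoC 1 /\ coef Q 0 = RtoC 1 /\
    (forall M, wnorm k Q M <= exp (1 + 4 * 4 ^ k * A)) /\
    (forall t, exp (- 2 * Re (ev F (eit t)) - eps) <= nsq (ev D (eit t))
               <= exp (- 2 * Re (ev F (eit t)) + eps)) /\
    (forall t, nsq (Cminus (Cmult (ev Q (eit t)) (ev D (eit t))) (RtoC 1)) <= eps).
Proof.
  intros Hk HF HA Heps.
  destruct (ev_eit_bounded F) as [b [Hb HbF]].
  set (B := b ^ 2); assert (HB : 0 <= B) by apply pow2_ge_0.
  assert (HBF : forall t, nsq (ev F (eit t)) <= B).
  { intros t; rewrite <- nsq_Cmod; apply pow_incr; split; [apply Cmod_ge_0|apply HbF]. }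
  (* This [m] makes 16 B/m at most [eps], which covers the errors 8 B/m and B/m in the exponents and
     2 B/m in the product. *)
  destruct (nfloor_ex (16 * (1 + B) / eps)) as [m0 [_ Hm0]].
  { apply Rdiv_le_0_compat; lra. }
  set (m := S m0); assert (Hm : 16 * (1 + B) < INR m * eps).
  { unfold m; rewrite S_INR. apply (Rmult_lt_compat_r eps) in Hm0; [|lra].
    unfold Rdiv in Hm0; rewrite Rmult_assoc, Rinv_l, Rmult_1_r in Hm0; lra. }
  assert (Hm1 : (1 <= m)%nat) by (unfold m; lia).
  assert (Hmp : 0 < INR m) by (apply lt_0_INR; lia).
  assert (Hm4 : 4 * (1 + B) <= INR m) by nra.
  assert (Hx : 16 * (B / INR m) <= eps).
  { replace (16 * (B / INR m)) with (16 * B / INR m) by (field; lra).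
    apply Rle_div_l; [lra|]. lra. }
  assert (Hx0 : 0 <= B / INR m) by (apply Rdiv_le_0_compat; lra).
  exists (epow F (- / INR m) m), (epow F (/ INR m) m).
  repeat split.
  - now apply coef_epow_0.
  - now apply coef_epow_0.
  - intros M; apply wnorm_epow; auto. now rewrite pow_inv.
  - rewrite ev_epow.
    eapply Rle_trans; [|apply (nsq_pow_bounds _ B m (HBF t) Hm4)].
    apply exp_mono; unfold Re. replace (8 * B / INR m) with (8 * (B / INR m)) by (field; lra). lra.
  - rewrite ev_epow.
    eapply Rle_trans; [apply (nsq_pow_bounds _ B m (HBF t) Hm4)|].
    apply exp_mono; unfold Re. lra.
  - intros t; rewrite !ev_epow, <- Cpow_mult_l.
    set (w := ev F (eit t)).
    (* (1 + w/m)(1 - w/m) = 1 - w^2/m^2, and its m-th power differs from 1 by at most exp(B/m) - 1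
       <= 2 B/m. *)
    replace (Cmult (Cplus (RtoC 1) (Cmult (RtoC (/ INR m)) w))
                   (Cplus (RtoC 1) (Cmult (RtoC (- / INR m)) w)))
      with (Cplus (RtoC 1) (Cmult (RtoC (- (/ INR m) ^ 2)) (Cmult w w))).
    2:{ destruct w; unfold Cmult, Cplus, RtoC; simpl; f_equal; ring. }
    set (u := Cmult (RtoC (- (/ INR m) ^ 2)) (Cmult w w)).
    assert (Hu : Cmod u <= B / INR m ^ 2).
    { unfold u; rewrite !Cmod_mult, Cmod_R, Rabs_Ropp, Rabs_pos_eq by apply pow2_ge_0.
      replace (Cmod w * Cmod w) with (nsq w) by (rewrite <- nsq_Cmod; ring).
      rewrite pow_inv; unfold Rdiv; rewrite Rmult_comm; apply Rmult_le_compat_r; [|apply HBF].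
      left; apply Rinv_0_lt_compat, pow_lt; lra. }
    assert (H := Cmod_pow_1_plus_minus_1 u m).
    assert (H2 : (1 + Cmod u) ^ m <= exp (B / INR m)).
    { eapply Rle_trans; [apply pow_1_plus_le_exp; generalize (Cmod_ge_0 u); lra|].
      apply exp_mono; apply Rle_trans with (INR m * (B / INR m ^ 2)).
      - apply Rmult_le_compat_l; lra.
      - right; field; lra. }
    assert (H3 : exp (B / INR m) <= 1 + 2 * (B / INR m)).
    { revert Hx Hx0; generalize (B / INR m); intros x Hx Hx0.
      assert (E : exp x * exp (- x) = 1) by (rewrite <- exp_plus, Rplus_opp_r, exp_0; reflexivity).
      assert (P := exp_pos x). assert (Q := exp_ineq1_le (- x)). nra. }
    rewrite <- nsq_Cmod.
    apply Rle_trans with (eps ^ 2); [|nra].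
    apply pow_incr; split; [apply Cmod_ge_0|]. lra.
Qed.

(** * Extremal property of the leading coefficient *)

Lemma continuous_poly_eval (a : nat -> C) (n : nat) (t : R) :
  continuous (fun t => fst (poly_eval a n (eit t))) t /\
  continuous (fun t => snd (poly_eval a n (eit t))) t.
Proof.
  destruct (continuous_ev (map a (seq 0 (S n))) t) as [H1 H2]; split.
  - revert H1; apply continuous_ext; intros x; now rewrite ev_map_seq.
  - revert H2; apply continuous_ext; intros x; now rewrite ev_map_seq.
Qed.

Lemma ip_re_correct (phi : R -> R) (a b : nat -> C) (m n : nat) :
  (forall t, continuous phi t) ->
  is_mean (fun t => Re (Cmult (poly_eval a m (eit t)) (Cconj (poly_eval b n (eit t)))) * phi t)
    (ip_re phi (poly_eval a m) (poly_eval b n)).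
Proof.
  intros Hphi; apply is_mean_continuous; intros t.
  destruct (continuous_poly_eval a m t), (continuous_poly_eval b n t); simpl.
  apply continuous_Rmult; [|apply Hphi].
  apply (continuous_minus (V := R_NormedModule)); apply continuous_Rmult; auto.
  now apply (continuous_opp (V := R_NormedModule)).
Qed.

Lemma ip_im_correct (phi : R -> R) (a b : nat -> C) (m n : nat) :
  (forall t, continuous phi t) ->
  is_mean (fun t => Im (Cmult (poly_eval a m (eit t)) (Cconj (poly_eval b n (eit t)))) * phi t)
    (ip_im phi (poly_eval a m) (poly_eval b n)).
Proof.
  intros Hphi; apply is_mean_continuous; intros t.
  destruct (continuous_poly_eval a m t), (continuous_poly_eval b n t); simpl.
  apply continuous_Rmult; [|apply Hphi].
  apply continuous_Rplus; apply continuous_Rmult; auto.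
  now apply (continuous_opp (V := R_NormedModule)).
Qed.

Lemma poly_eval_0 (a : nat -> C) (z : C) : poly_eval a 0 z = a 0%nat.
Proof. unfold poly_eval; rewrite sum_O; simpl; ring. Qed.

Lemma poly_eval_S (a : nat -> C) (n : nat) (z : C) :
  poly_eval a (S n) z = Cplus (poly_eval a n z) (Cmult (a (S n)) (Cpow z (S n))).
Proof. unfold poly_eval; now rewrite sum_Sn. Qed.

(** Subtracting c b cancels the top coefficient of [a], so the remainder has degree at most [m]. *)
Lemma poly_eval_reduce (a b : nat -> C) (c : C) (m : nat) (z : C) :
  a (S m) = Cmult c (b (S m)) ->
  poly_eval a (S m) z
  = Cplus (poly_eval (fun j => Cminus (a j) (Cmult c (b j))) m z)
          (Cmult c (poly_eval b (S m) z)).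
Proof.
  intros E; rewrite !poly_eval_S, E.
  replace (poly_eval a m z)
    with (Cplus (poly_eval (fun j => Cminus (a j) (Cmult c (b j))) m z) (Cmult c (poly_eval b m z)));
    [ring|].
  clear E; induction m as [|m IH].
  - rewrite !poly_eval_0; ring.
  - rewrite !poly_eval_S, <- IH; ring.
Qed.

Section Orthonormal.
Variables (phi : R -> R) (p : nat -> nat -> C).
Hypothesis phi_cont : forall t, continuous phi t.
Hypothesis p_orth : orthonormal_family phi p.

Lemma leading_coef_neq_0 (n : nat) : p n n <> RtoC 0.
Proof.
  destruct p_orth as [_ H]; destruct (H n) as [_ H0]; intros E; rewrite E in H0.
  simpl in H0; lra.
Qed.

Lemma ip_reduce (a : nat -> C) (c : C) (m n : nat) :
  a (S m) = Cmult c (p (S m) (S m)) ->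
  let r := fun j => Cminus (a j) (Cmult c (p (S m) j)) in
  ip_re phi (poly_eval a (S m)) (poly_eval (p n) n)
  = ip_re phi (poly_eval r m) (poly_eval (p n) n)
    + (Re c * ip_re phi (poly_eval (p (S m)) (S m)) (poly_eval (p n) n)
       - Im c * ip_im phi (poly_eval (p (S m)) (S m)) (poly_eval (p n) n)) /\
  ip_im phi (poly_eval a (S m)) (poly_eval (p n) n)
  = ip_im phi (poly_eval r m) (poly_eval (p n) n)
    + (Re c * ip_im phi (poly_eval (p (S m)) (S m)) (poly_eval (p n) n)
       + Im c * ip_re phi (poly_eval (p (S m)) (S m)) (poly_eval (p n) n)).
Proof.
  intros E r; split; apply is_mean_unique.
  - eapply is_mean_ext;
      [|apply is_mean_plus; [now apply ip_re_correct|apply is_mean_minus;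
          apply is_mean_scal; [now apply ip_re_correct|now apply ip_im_correct]]].
    intros t; cbv beta; rewrite (poly_eval_reduce a (p (S m)) c m _ E); fold r.
    generalize (poly_eval r m (eit t)) (poly_eval (p (S m)) (S m) (eit t)) (poly_eval (p n) n (eit t)).
    intros x y z; unfold Re, Im; simpl; ring.
  - eapply is_mean_ext;
      [|apply is_mean_plus; [now apply ip_im_correct|apply is_mean_plus;
          apply is_mean_scal; [now apply ip_im_correct|now apply ip_re_correct]]].
    intros t; cbv beta; rewrite (poly_eval_reduce a (p (S m)) c m _ E); fold r.
    generalize (poly_eval r m (eit t)) (poly_eval (p (S m)) (S m) (eit t)) (poly_eval (p n) n (eit t)).
    intros x y z; unfold Re, Im; simpl; ring.
Qed.

(** Induction on the degree: a multiple of the orthonormal polynomial of degree m removes the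
    leading term, since its own leading coefficient is nonzero, and that multiple is orthogonal to
    the one of degree n. *)
Lemma orthogonal_lower_degree (n m : nat) (a : nat -> C) : (m < n)%nat ->
  ip_re phi (poly_eval a m) (poly_eval (p n) n) = 0 /\
  ip_im phi (poly_eval a m) (poly_eval (p n) n) = 0.
Proof.
  revert a; induction m as [|m IH]; intros a Hmn.
  - destruct (proj1 p_orth 0%nat n) as [H1 H2].
    replace (Nat.eqb 0 n) with false in H1 by (symmetry; apply Nat.eqb_neq; lia).
    set (c := Cdiv (a 0%nat) (p 0%nat 0%nat)).
    assert (E : forall z, poly_eval a 0 z = Cmult c (poly_eval (p 0%nat) 0 z)).
    { intros z; rewrite !poly_eval_0; unfold c; field.
      apply leading_coef_neq_0. }
    split; apply is_mean_unique.
    + apply (is_mean_eq _ (Re c * 0 - Im c * 0)); [ring|].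
      rewrite <- H1 at 1; rewrite <- H2.
      eapply is_mean_ext; [|apply is_mean_minus; apply is_mean_scal;
        [now apply ip_re_correct|now apply ip_im_correct]].
      intros t; cbv beta; rewrite E.
      generalize (poly_eval (p 0%nat) 0 (eit t)) (poly_eval (p n) n (eit t)).
      intros x y; unfold Re, Im; simpl; ring.
    + apply (is_mean_eq _ (Re c * 0 + Im c * 0)); [ring|].
      rewrite <- H2 at 1; rewrite <- H1.
      eapply is_mean_ext; [|apply is_mean_plus; apply is_mean_scal;
        [now apply ip_im_correct|now apply ip_re_correct]].
      intros t; cbv beta; rewrite E.
      generalize (poly_eval (p 0%nat) 0 (eit t)) (poly_eval (p n) n (eit t)).
      intros x y; unfold Re, Im; simpl; ring.
  - destruct (proj1 p_orth (S m) n) as [H1 H2].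
    replace (Nat.eqb (S m) n) with false in H1 by (symmetry; apply Nat.eqb_neq; lia).
    destruct (ip_reduce a (Cdiv (a (S m)) (p (S m) (S m))) m n) as [E1 E2].
    { field; apply leading_coef_neq_0. }
    destruct (IH (fun j => Cminus (a j) (Cmult (Cdiv (a (S m)) (p (S m) (S m))) (p (S m) j)))) as [F1 F2];
      [lia|].
    rewrite E1, E2, F1, F2, H1, H2; split; ring.
Qed.

(** For a monic A of degree n+1, the difference of A and p/g (p of degree n+1, g its leading
    coefficient) has lower degree, so A has inner product 1/g with p. Then 0 <= |A - p/g|^2 = x -
    1/g^2 in the norm of the weight. *)
Lemma extremal_property (n : nat) (a : nat -> C) (x : R) :
  a (S n) = RtoC 1 ->
  is_mean (fun t => nsq (poly_eval a (S n) (eit t)) * phi t) x ->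
  (forall t, 0 <= phi t) ->
  1 <= Re (p (S n) (S n)) ^ 2 * x.
Proof.
  intros Ha Hx Hpos.
  destruct (proj2 p_orth (S n)) as [Him Hre].
  set (g := Re (p (S n) (S n))) in *.
  assert (Hp : p (S n) (S n) = RtoC g).
  { unfold g; destruct (p (S n) (S n)) as [u v]; simpl in *; unfold RtoC; now rewrite Him. }
  destruct (ip_reduce a (RtoC (/ g)) n (S n)) as [E _].
  { rewrite Ha, Hp, <- RtoC_mult; f_equal; field; lra. }
  destruct (orthogonal_lower_degree (S n) n
    (fun j => Cminus (a j) (Cmult (RtoC (/ g)) (p (S n) j)))) as [F _]; [lia|].
  destruct (proj1 p_orth (S n) (S n)) as [H1 H2]; rewrite Nat.eqb_refl in H1.
  rewrite F, H1, H2 in E; simpl in E.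
  assert (M1 := ip_re_correct phi a (p (S n)) (S n) (S n) phi_cont).
  assert (M2 := ip_re_correct phi (p (S n)) (p (S n)) (S n) (S n) phi_cont).
  rewrite E in M1; rewrite H1 in M2.
  (* The parenthesis is the inner product of A with p as [E] delivers it, before simplification to
     1/g. *)
  assert (H : 0 <= x - 2 * / g * (0 + (/ g * 1 - 0 * 0)) + (/ g) ^ 2 * 1).
  { eapply is_mean_le; [apply (is_mean_const 0)| |].
    - apply is_mean_plus; [apply is_mean_minus; [exact Hx|]|];
        apply is_mean_scal; [exact M1|exact M2].
    - intros t _; cbv beta.
      generalize (poly_eval a (S n) (eit t)) (poly_eval (p (S n)) (S n) (eit t)); intros A B.
      replace (nsq A * phi t - 2 * / g * (Re (Cmult A (Cconj B)) * phi t)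
        + (/ g) ^ 2 * (Re (Cmult B (Cconj B)) * phi t))
        with (nsq (Cminus A (Cmult (RtoC (/ g)) B)) * phi t)
        by (unfold nsq; simpl; ring).
      apply Rmult_le_pos; [apply nsq_pos|apply Hpos]. }
  replace (x - 2 * / g * (0 + (/ g * 1 - 0 * 0)) + (/ g) ^ 2 * 1) with (x - (/ g) ^ 2) in H by ring.
  replace 1 with (g ^ 2 * (/ g) ^ 2) by (field; lra).
  apply Rmult_le_compat_l; [apply pow2_ge_0|lra].
Qed.

End Orthonormal.

(** * Comparison of the weight with the modulus of a polynomial *)

(** The last index [length p] lies outside the list and contributes the default 0; the empty list
    then needs no exception. *)
Lemma sumsq_coef (p : list C) : sumsq p = sum_f_R0 (fun j => nsq (coef p j)) (length p).
Proof.
  induction p as [|a p IH]; [simpl; unfold coef, nsq; simpl; ring|].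
  simpl length; rewrite sum_f_R0_head; simpl; now rewrite IH.
Qed.

(** Together with [parseval] this is |P(0)|^2 <= mean of |P|^2. *)
Lemma sumsq_ge_coef_0 (p : list C) : nsq (coef p 0) <= sumsq p.
Proof.
  destruct p as [|a p]; simpl; [unfold coef, nsq; simpl; lra|].
  generalize (sumsq_pos p); unfold coef; simpl; lra.
Qed.

Lemma sum_shift_le (f : nat -> R) (s l : nat) : (forall j, 0 <= f j) ->
  sum_f_R0 (fun j => f (s + j)%nat) l <= sum_f_R0 f (s + l).
Proof.
  revert f; induction s as [|s IH]; intros f Hf; [apply Rle_refl|].
  rewrite Nat.add_succ_l, sum_f_R0_head.
  specialize (IH (fun j => f (S j)) (fun j => Hf (S j))); simpl in IH.
  generalize (Hf 0%nat); simpl; lra.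
Qed.

Lemma coef_skipn (p : list C) (s j : nat) : coef (skipn s p) j = coef p (s + j).
Proof. apply nth_skipn. Qed.

(** Every coefficient that remains has index at least n+1, hence weight at least n^(2k). This is the
    source of the rate. *)
Lemma sumsq_skipn_le (k n : nat) (p : list C) (W : R) :
  (forall M, wnorm k p M <= W) ->
  INR n ^ (2 * k) * sumsq (skipn (S n) p) <= W.
Proof.
  intros HW; eapply Rle_trans; [|apply (HW (S n + length (skipn (S n) p))%nat)].
  rewrite sumsq_coef, <- sum_f_R0_scal.
  eapply Rle_trans; [|apply (sum_shift_le (fun j => wt k j * nsq (coef p j)))].
  - apply sum_Rle; intros j _; rewrite coef_skipn.
    apply Rmult_le_compat_r; [apply nsq_pos|].
    apply pow_incr; split; [apply pos_INR|apply le_INR; lia].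
  - intros j; apply Rmult_le_pos; [left; apply wt_pos|apply nsq_pos].
Qed.

Lemma ev_repeat_0 (n : nat) (z : C) : ev (repeat (RtoC 0) n) z = RtoC 0.
Proof. induction n as [|n IH]; simpl; [reflexivity|]; rewrite IH; ring. Qed.

Lemma coef_app_zeros (p : list C) (n j : nat) : coef (p ++ repeat (RtoC 0) n) j = coef p j.
Proof.
  unfold coef; destruct (Nat.lt_ge_cases j (length p)).
  - now apply app_nth1.
  - rewrite app_nth2, nth_repeat, nth_overflow; auto.
Qed.

Lemma truncation (k n : nat) (Q : list C) (W : R) :
  coef Q 0 = RtoC 1 -> (forall M, wnorm k Q M <= W) ->
  exists T U : list C,
    length T = S n /\ coef T 0 = RtoC 1 /\
    (forall z, ev Q z = Cplus (ev T z) (Cmult (Cpow z (S n)) (ev U z))) /\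
    INR n ^ (2 * k) * sumsq U <= W.
Proof.
  (* [Q] may be shorter than n+1; padding with zeros gives its initial segment exactly that
     length. *)
  intros H0 HW; set (Q' := Q ++ repeat (RtoC 0) (S n)).
  assert (HT : length (firstn (S n) Q') = S n).
  { rewrite length_firstn; unfold Q'; rewrite length_app, repeat_length; lia. }
  exists (firstn (S n) Q'), (skipn (S n) Q'); repeat split; auto.
  - rewrite <- H0, <- (coef_app_zeros Q (S n)); fold Q'. now destruct Q'.
  - intros z; rewrite <- HT at 2; rewrite <- ev_app, firstn_skipn.
    unfold Q'; rewrite ev_app, ev_repeat_0; ring.
  - apply sumsq_skipn_le; intros M; eapply Rle_trans; [|apply (HW M)].
    right; apply sum_eq; intros j _; unfold Q'; now rewrite coef_app_zeros.
Qed.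

Lemma nsq_minus_le (y z : C) : nsq (Cminus y z) <= 2 * nsq y + 2 * nsq z.
Proof.
  unfold nsq; destruct y as [a b], z as [c d]; simpl.
  generalize (pow2_ge_0 (a + c)) (pow2_ge_0 (b + d)); nra.
Qed.

(* The product [T D] has constant coefficient 1, so its mean square exceeds 1
   exactly by the mean square of [T D - 1]. *)
Lemma mean_trial_le (k n : nat) (D Q : list C) (W G eps : R) :
  coef D 0 = RtoC 1 -> coef Q 0 = RtoC 1 -> (forall M, wnorm k Q M <= W) ->
  (1 <= n)%nat -> 0 <= G ->
  (forall t, - PI <= t <= PI -> nsq (ev D (eit t)) <= G) ->
  (forall t, nsq (Cminus (Cmult (ev Q (eit t)) (ev D (eit t))) (RtoC 1)) <= eps) ->
  exists (T : list C) (x : R), length T = S n /\ coef T 0 = RtoC 1 /\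
    is_mean (fun t => nsq (ev T (eit t)) * nsq (ev D (eit t))) x /\
    x <= 1 + 2 * eps + 2 * G * W / INR n ^ (2 * k).
Proof.
  intros HD HQ HW Hn HG HDG Heps.
  destruct (truncation k n Q W HQ HW) as [T [U [HT [HT0 [Hev HU]]]]].
  exists T, (sumsq (pmul T D)); repeat split; auto.
  - eapply is_mean_ext; [|apply parseval].
    intros t; cbv beta; now rewrite ev_pmul, nsq_mult.
  - assert (H0 : coef (pmul T D) 0 = RtoC 1) by (rewrite coef_pmul_0, HT0, HD; ring).
    assert (Hr : forall z, ev (pmul T D) z = Cmult (ev T z) (ev D z)) by (intros; apply ev_pmul).
    destruct (pmul T D) as [|b r].
    { exfalso; unfold coef in H0; simpl in H0; apply RtoC_inj in H0; lra. }
    unfold coef in H0; simpl in H0; subst b.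
    assert (Hn0 : 0 < INR n ^ (2 * k)) by (apply pow_lt, lt_0_INR; lia).
    assert (sumsq r <= 2 * eps + 2 * G * sumsq U).
    { eapply is_mean_le; [apply parseval|
        apply is_mean_plus; [apply is_mean_const|apply is_mean_scal, parseval]|].
      intros t Ht; cbv beta; set (z := eit t).
      assert (Hz : nsq z = 1) by apply nsq_eit.
      (* On the circle |r| = |z r|, and z r = T D - 1 = (Q D - 1) - z^(n+1) U D. *)
      replace (nsq (ev r z)) with
        (nsq (Cminus (Cminus (Cmult (ev Q z) (ev D z)) (RtoC 1)) (Cmult (Cmult (Cpow z (S n)) (ev U z)) (ev D z)))).
      - eapply Rle_trans; [apply nsq_minus_le|].
        rewrite !nsq_mult, nsq_pow, Hz, pow1.
        assert (H1 := Heps t); assert (H2 := HDG t Ht); fold z in H1, H2.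
        assert (nsq (ev U z) * nsq (ev D z) <= nsq (ev U z) * G)
          by (apply Rmult_le_compat_l; [apply nsq_pos|easy]).
        lra.
      - specialize (Hr z); simpl in Hr.
        transitivity (nsq (Cmult z (ev r z))); [f_equal|rewrite nsq_mult, Hz; ring].
        transitivity (Cminus (Cmult (ev T z) (ev D z)) (RtoC 1)).
        + rewrite Hev; ring.
        + rewrite <- Hr; ring. }
    assert (sumsq U <= W / INR n ^ (2 * k)).
    { apply Rle_div_r; [easy|]. lra. }
    assert (2 * G * sumsq U <= 2 * G * (W / INR n ^ (2 * k)))
      by (apply Rmult_le_compat_l; lra).
    change (sumsq (RtoC 1 :: r)) with (nsq (RtoC 1) + sumsq r).
    replace (nsq (RtoC 1)) with 1 by (unfold nsq; simpl; ring).
    unfold Rdiv in *; lra.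
Qed.

(** Letting [eps] tend to 0: this removes the approximation error from the final bounds. *)
Lemma le_of_forall_exp (a b : R) :
  0 <= b -> (forall eps, 0 < eps <= 1 -> a <= b * exp (2 * eps) + b * eps) -> a <= b.
Proof.
  intros Hb H; destruct (Rle_lt_dec a b) as [|Hab]; [easy|exfalso].
  assert (Hexp : forall e, 0 < e <= 1 / 4 -> exp (2 * e) <= 1 + 4 * e).
  { intros e He.
    assert (E : exp (2 * e) * exp (- (2 * e)) = 1)
      by (rewrite <- exp_plus, Rplus_opp_r, exp_0; reflexivity).
    assert (P := exp_pos (2 * e)); assert (Q := exp_ineq1_le (- (2 * e))). nra. }
  (* The hypothesis at e gives a <= b + 5 b e, while 5 b d is at most half of a - b. *)
  set (d := (a - b) / (10 * (1 + b))).
  assert (Hd : 0 < d) by (apply Rdiv_lt_0_compat; lra).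
  assert (Ed : d * (10 * (1 + b)) = a - b) by (unfold d; field; lra).
  set (e := Rmin d (1 / 4)).
  assert (He : 0 < e <= 1 / 4) by (split; [apply Rmin_glb_lt; lra|apply Rmin_r]).
  assert (Hed : e <= d) by apply Rmin_l.
  assert (H1 := H e ltac:(lra)); assert (H2 := Hexp e He).
  assert (b * exp (2 * e) <= b * (1 + 4 * e)) by now apply Rmult_le_compat_l.
  assert (b * e <= b * d) by now apply Rmult_le_compat_l.
  nra.
Qed.

(** The interface between Fourier analysis and the extremal problem. [A] is fixed before [eps], so
    the bound on the norms is uniform in the approximation. *)
Definition trig_approximable (k : nat) (A V0 : R) (V : R -> R) : Prop :=
  forall eps, 0 < eps <= 1 ->
  exists F : list C, coef F 0 = RtoC 0 /\ (forall M, wnorm k F M <= A) /\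
    forall t, - PI <= t <= PI -> Rabs (V t - (V0 + 2 * Re (ev F (eit t)))) <= eps.

(** One [eps] in the exponent comes from replacing V by V0 + 2 Re F, the other from replacing
    exp(-F) by [D]. *)
Lemma weight_polynomials (k : nat) (A V0 eps : R) (V : R -> R) :
  (1 <= k)%nat -> trig_approximable k A V0 V -> 0 < eps <= 1 ->
  exists D Q : list C,
    coef D 0 = RtoC 1 /\ coef Q 0 = RtoC 1 /\
    (forall M, wnorm k Q M <= exp (1 + 4 * 4 ^ k * A)) /\
    (forall t, - PI <= t <= PI ->
       exp (- V0 - 2 * eps) * nsq (ev D (eit t)) <= exp (- V t)
       <= exp (- V0 + 2 * eps) * nsq (ev D (eit t))) /\
    (forall t, nsq (Cminus (Cmult (ev Q (eit t)) (ev D (eit t))) (RtoC 1)) <= eps).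
Proof.
  intros Hk HV Heps; destruct (HV eps Heps) as [F [HF0 [HFA HF]]].
  destruct (exp_polynomials k F A eps Hk HF0 HFA Heps) as [D [Q [H1 [H2 [H3 [H4 H5]]]]]].
  exists D, Q; repeat split; auto;
    assert (HVt := HF t H); apply Rabs_le_between in HVt; destruct (H4 t) as [H6 H7].
  - eapply Rle_trans; [apply Rmult_le_compat_l; [left; apply exp_pos|exact H7]|].
    rewrite <- exp_plus; apply exp_mono; lra.
  - eapply Rle_trans; [|apply Rmult_le_compat_l; [left; apply exp_pos|exact H6]].
    rewrite <- exp_plus; apply exp_mono; lra.
Qed.

Lemma leading_coef_bounds (k : nat) (A V0 Phi : R) (V : R -> R) (p : nat -> nat -> C) (n : nat) :
  (1 <= k)%nat -> trig_approximable k A V0 V ->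
  (forall t, continuous V t) -> (forall t, - PI <= t <= PI -> exp (- V t) <= Phi) ->
  orthonormal_family (fun t => exp (- V t)) p ->
  (1 <= n)%nat ->
  Re (p n n) ^ 2 * exp (- V0) <= 1 /\
  1 <= Re (p n n) ^ 2 * exp (- V0)
       * (1 + 2 * (exp (V0 + 2) * Phi) * exp (1 + 4 * 4 ^ k * A) / INR n ^ (2 * k)).
Proof.
  intros Hk HV Vc HPhi Hp Hn.
  assert (phic : forall t, continuous (fun t => exp (- V t)) t).
  { intros t; apply (continuous_comp (fun t => - V t) exp).
    - apply (continuous_opp (V := R_NormedModule)), Vc.
    - apply continuous_derivable; auto_derive; easy. }
  set (g := Re (p n n)); assert (Hg : 0 <= g ^ 2) by apply pow2_ge_0.
  set (W := exp (1 + 4 * 4 ^ k * A)); set (G := exp (V0 + 2) * Phi).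
  assert (HPhi0 : 0 <= Phi).
  { eapply Rle_trans; [left; apply (exp_pos (- V 0))|apply HPhi; generalize PI_RGT_0; lra]. }
  assert (HG : 0 <= G) by (apply Rmult_le_pos; [left; apply exp_pos|easy]).
  assert (HW : 0 < W) by apply exp_pos.
  assert (Hn0 : 0 < INR n ^ (2 * k)) by (apply pow_lt, lt_0_INR; lia).
  set (K := 2 * G * W / INR n ^ (2 * k)).
  assert (HK : 0 <= K) by (apply Rdiv_le_0_compat; [|easy]; apply Rmult_le_pos; lra).
  split; apply le_of_forall_exp; try lra.
  - intros eps Heps.
    destruct (weight_polynomials k A V0 eps V Hk HV Heps) as [D [Q [H1 [_ [_ [H4 _]]]]]].
    (* The reversed orthonormal polynomial [P'] has a constant coefficient of modulus g, and so has
       [P' D] because D(0) = 1. Hence g^2 is at most the mean of |P D|^2, which is close to exp(V0)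
       times the mean 1 of |P|^2 phi. *)
    set (P := map (p n) (seq 0 (S n))); set (P' := rev (map Cconj P)).
    assert (HR0 : nsq (coef P' 0) = g ^ 2).
    { unfold P', P; rewrite seq_S, !map_app, rev_app_distr; unfold coef; simpl.
      destruct (proj2 Hp n) as [Him _].
      unfold nsq, g; simpl; unfold Im in Him; rewrite Him; unfold Re; ring. }
    assert (M1 : is_mean (fun t => nsq (ev P (eit t)) * exp (- V t)) 1).
    { destruct (proj1 Hp n n) as [E _]; rewrite Nat.eqb_refl in E; rewrite <- E.
      eapply is_mean_ext; [|now apply ip_re_correct].
      intros t; unfold P; rewrite ev_map_seq.
      change (poly_eval (fun j => p n (0 + j)%nat) n (eit t)) with (poly_eval (p n) n (eit t)).
      generalize (poly_eval (p n) n (eit t)); intros z; unfold nsq; simpl; ring. }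
    assert (M2 := is_mean_scal (exp (- V0 - 2 * eps)) _ _ (parseval (pmul P' D))).
    assert (H : exp (- V0 - 2 * eps) * sumsq (pmul P' D) <= 1).
    { eapply is_mean_le; [exact M2|exact M1|]. intros t Ht; cbv beta.
      rewrite ev_pmul, nsq_mult; unfold P'; rewrite nsq_ev_rev_conj.
      destruct (H4 t Ht) as [H5 _]; assert (0 <= nsq (ev P (eit t))) by apply nsq_pos.
      apply (Rmult_le_compat_l (nsq (ev P (eit t)))) in H5; lra. }
    assert (H6 : g ^ 2 <= sumsq (pmul P' D)).
    { eapply Rle_trans; [|apply sumsq_ge_coef_0].
      rewrite coef_pmul_0, nsq_mult, HR0, H1; unfold nsq; simpl; lra. }
    replace (- V0 - 2 * eps) with (- V0 + - (2 * eps)) in H by ring.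
    rewrite exp_plus, (exp_Ropp (2 * eps)) in H.
    assert (P1 := exp_pos (2 * eps)); assert (P2 := exp_pos (- V0)).
    assert (E : exp (- V0) * g ^ 2 * / exp (2 * eps) <= 1).
    { eapply Rle_trans; [|exact H].
      rewrite !Rmult_assoc; apply Rmult_le_compat_l; [lra|].
      rewrite Rmult_comm; apply Rmult_le_compat_l; [|easy]. left; now apply Rinv_0_lt_compat. }
    apply (Rmult_le_compat_r (exp (2 * eps))) in E; [|lra].
    rewrite Rmult_assoc, Rinv_l in E; lra.
  - apply Rmult_le_pos; [apply Rmult_le_pos; [easy|left; apply exp_pos]|].
    lra.
  - intros eps Heps.
    (* With [eps / 16] the additive error is at most 3 * 2 * (eps/16) <= eps, where 3 bounds the
       exponential factor. *)
    assert (Heps4 : 0 < eps / 16 <= 1) by lra.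
    destruct (weight_polynomials k A V0 (eps / 16) V Hk HV Heps4) as [D [Q [H1 [H2 [H3 [H4 H5]]]]]].
    destruct (mean_trial_le k n D Q W G (eps / 16)) as [T [x [HT [HT0 [Mx Hx]]]]]; auto.
    { intros t Ht; destruct (H4 t Ht) as [H6 _]; specialize (HPhi t Ht).
      assert (E : exp (V0 + 2 * (eps / 16)) * exp (- V0 - 2 * (eps / 16)) = 1).
      { rewrite <- exp_plus, <- exp_0; f_equal; ring. }
      apply (Rmult_le_compat_l (exp (V0 + 2 * (eps / 16)))) in H6; [|left; apply exp_pos].
      rewrite <- Rmult_assoc, E, Rmult_1_l in H6.
      eapply Rle_trans; [exact H6|]; unfold G.
      apply Rmult_le_compat; auto; try (left; apply exp_pos). apply exp_mono; lra. }
    fold K in Hx.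
    (* T has constant coefficient 1, so its reversal is a monic competitor in [extremal_property],
       with the same modulus on the circle. *)
    set (L := rev (map Cconj T)).
    assert (HL : length L = S n) by (unfold L; now rewrite length_rev, length_map).
    destruct n as [|n']; [lia|].
    set (y := mean (fun t => nsq (ev L (eit t)) * exp (- V t))).
    assert (My : is_mean (fun t => nsq (ev L (eit t)) * exp (- V t)) y).
    { apply is_mean_continuous; intros t; apply continuous_Rmult; [apply continuous_nsq_ev|apply phic]. }
    assert (Hext : 1 <= g ^ 2 * y).
    { apply (extremal_property (fun t => exp (- V t)) p phic Hp n' (coef L)).
      - unfold coef, L; rewrite rev_nth; rewrite length_map, HT; [|lia].
        rewrite Nat.sub_diag. destruct T as [|b T]; [easy|].
        unfold coef in HT0; simpl in HT0; simpl; rewrite HT0; unfold Cconj, RtoC; simpl.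
        f_equal; ring.
      - eapply is_mean_ext; [|exact My]. intros t; cbv beta; now rewrite poly_eval_coef.
      - intros t; left; apply exp_pos. }
    assert (Hyx : y <= exp (- V0 + 2 * (eps / 16)) * x).
    { eapply is_mean_le; [exact My|apply is_mean_scal, Mx|].
      intros t Ht; cbv beta; unfold L; rewrite nsq_ev_rev_conj.
      destruct (H4 t Ht) as [_ H6]. assert (H7 := nsq_pos (ev T (eit t))).
      apply (Rmult_le_compat_l _ _ _ H7) in H6. lra. }
    rewrite exp_plus in Hyx.
    assert (P2 := exp_pos (- V0)); assert (P3 := exp_pos (2 * (eps / 16))).
    assert (P4 : exp (2 * (eps / 16)) <= exp (2 * eps)) by (apply exp_mono; lra).
    assert (P5 : exp (2 * (eps / 16)) <= 3) by (eapply Rle_trans; [|apply exp_le_3]; apply exp_mono; lra).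
    assert (Hx' : exp (2 * (eps / 16)) * x <= (1 + K) * exp (2 * eps) + (1 + K) * eps).
    { apply Rle_trans with (exp (2 * (eps / 16)) * (1 + K) + exp (2 * (eps / 16)) * (2 * (eps / 16))).
      - rewrite <- Rmult_plus_distr_l; apply Rmult_le_compat_l; lra.
      - apply Rplus_le_compat.
        + rewrite Rmult_comm; apply Rmult_le_compat_l; lra.
        + apply Rle_trans with (3 * (2 * (eps / 16))); [apply Rmult_le_compat_r; lra|]. nra. }
    eapply Rle_trans; [exact Hext|].
    eapply Rle_trans; [apply Rmult_le_compat_l; [easy|exact Hyx]|].
    replace (g ^ 2 * (exp (- V0) * exp (2 * (eps / 16)) * x))
      with (g ^ 2 * exp (- V0) * (exp (2 * (eps / 16)) * x)) by ring.
    eapply Rle_trans; [apply Rmult_le_compat_l; [|exact Hx']|].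
    + apply Rmult_le_pos; lra.
    + right; fold K; ring.
Qed.

(** * Fourier coefficients *)

(** [fcos f j] and [- fsin f j] are the real and imaginary parts of the j-th complex Fourier
    coefficient, and [energy] is its squared modulus. *)
Definition fcos (f : R -> R) (j : nat) : R := mean (fun t => f t * cos (INR j * t)).
Definition fsin (f : R -> R) (j : nat) : R := mean (fun t => f t * sin (INR j * t)).
Definition energy (f : R -> R) (j : nat) : R := fcos f j ^ 2 + fsin f j ^ 2.

Lemma continuous_cos_scal (a t : R) : continuous (fun t => cos (a * t)) t.
Proof. apply continuous_derivable; auto_derive; easy. Qed.

Lemma continuous_sin_scal (a t : R) : continuous (fun t => sin (a * t)) t.
Proof. apply continuous_derivable; auto_derive; easy. Qed.

Lemma fcos_correct (f : R -> R) (j : nat) : (forall t, continuous f t) ->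
  is_mean (fun t => f t * cos (INR j * t)) (fcos f j).
Proof.
  intros Hf; apply is_mean_continuous; intros t.
  apply continuous_Rmult; [apply Hf|apply continuous_cos_scal].
Qed.

Lemma fsin_correct (f : R -> R) (j : nat) : (forall t, continuous f t) ->
  is_mean (fun t => f t * sin (INR j * t)) (fsin f j).
Proof.
  intros Hf; apply is_mean_continuous; intros t.
  apply continuous_Rmult; [apply Hf|apply continuous_sin_scal].
Qed.

(** Integration by parts: the derivatives of f cos(jt) and f sin(jt) have mean 0 by periodicity. *)
Lemma energy_derive (f df : R -> R) (j : nat) :
  (forall t, is_derive f t (df t)) -> (forall t, continuous df t) -> f PI = f (- PI) ->
  energy df j = INR j ^ 2 * energy f j.
Proof.
  intros Hd Hc Hp.
  assert (Hf : forall t, continuous f t)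
    by (intros t; apply continuous_derivable; now exists (df t)).
  assert (E1 : fcos df j = INR j * fsin f j).
  { apply is_mean_unique; rewrite <- (Rplus_0_l (INR j * fsin f j)).
    eapply is_mean_ext; [|apply is_mean_plus; [|apply is_mean_scal, fsin_correct, Hf]].
    2:{ apply (is_mean_derive (fun t => f t * cos (INR j * t))
          (fun t => df t * cos (INR j * t) + - (INR j) * (f t * sin (INR j * t)))).
        - intros t; assert (H := Hd t); auto_derive; [now exists (df t)|].
          replace (Derive (fun x : R => f x) t) with (df t) by (symmetry; now apply is_derive_unique); ring.
        - intros t; apply continuous_Rplus; [apply continuous_Rmult|]; auto.
          + apply continuous_cos_scal.
          + apply continuous_Rmult; [apply continuous_const|].
            apply continuous_Rmult; [apply Hf|apply continuous_sin_scal].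
        - now rewrite Hp, cos_at_PI. }
    intros t; cbv beta; ring. }
  assert (E2 : fsin df j = - INR j * fcos f j).
  { apply is_mean_unique; rewrite <- (Rplus_0_l (- INR j * fcos f j)).
    eapply is_mean_ext; [|apply is_mean_plus; [|apply is_mean_scal, fcos_correct, Hf]].
    2:{ apply (is_mean_derive (fun t => f t * sin (INR j * t))
          (fun t => df t * sin (INR j * t) + INR j * (f t * cos (INR j * t)))).
        - intros t; assert (H := Hd t); auto_derive; [now exists (df t)|].
          replace (Derive (fun x : R => f x) t) with (df t) by (symmetry; now apply is_derive_unique); ring.
        - intros t; apply continuous_Rplus; [apply continuous_Rmult|]; auto.
          + apply continuous_sin_scal.
          + apply continuous_Rmult; [apply continuous_const|].
            apply continuous_Rmult; [apply Hf|apply continuous_cos_scal].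
        - now rewrite Hp, sin_at_PI. }
    intros t; cbv beta; ring. }
  unfold energy; rewrite E1, E2; ring.
Qed.

(** With an antiderivative P of f, the function P(PI + c) - P(-PI + c) of c has derivative f(PI + c)
    - f(-PI + c) = 0, so it agrees at c = 0 and c = h. *)
Lemma is_mean_translate (f : R -> R) (h : R) : 0 < h ->
  (forall t, continuous f t) -> (forall t, f (t + 2 * PI) = f t) ->
  is_mean (fun t => f (t + h)) (mean f).
Proof.
  intros Hh Hc Hp.
  set (P := fun x => RInt f 0 x).
  assert (HP : forall x, is_derive P x (f x)).
  { intros x; apply (is_derive_RInt (V := R_CompleteNormedModule) f P 0 x); [|apply Hc].
    apply filter_forall; intros y; apply (RInt_correct (V := R_CompleteNormedModule)).
    apply (ex_RInt_continuous (V := R_CompleteNormedModule)); intros; apply Hc. }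
  assert (HPh : forall c x, is_derive (fun x => P (x + c)) x (f (x + c))).
  { intros c x; evar_last.
    - apply (is_derive_comp P (fun x => x + c)); [apply HP|].
      auto_derive; easy.
    - unfold scal; simpl; unfold mult; simpl; ring. }
  assert (Hch : forall t, continuous (fun t => f (t + h)) t).
  { intros t; apply (continuous_comp (fun t => t + h) f); [|apply Hc].
    apply continuous_derivable; auto_derive; easy. }
  assert (E : P (PI + 0) - P (- PI + 0) = P (PI + h) - P (- PI + h)).
  { apply (eq_is_derive (V := R_NormedModule) (fun c => P (PI + c) - P (- PI + c)) 0 h); [|easy].
    intros c _; evar_last.
    - apply (is_derive_minus (V := R_NormedModule) (fun c => P (PI + c)) (fun c => P (- PI + c))).
      + apply (is_derive_ext (fun c => P (c + PI))); [intros; f_equal; ring|apply HPh].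
      + apply (is_derive_ext (fun c => P (c + - PI))); [intros; f_equal; ring|apply HPh].
    - unfold minus, plus, opp, zero; simpl.
      rewrite <- (Hp (c + - PI)). replace (c + - PI + 2 * PI) with (c + PI) by ring. ring. }
  unfold is_mean.
  replace (2 * PI * mean f) with (minus (P (PI + h)) (P (- PI + h))).
  - apply (is_RInt_derive (V := R_CompleteNormedModule) (fun x => P (x + h))); auto.
  - change (P (PI + h) - P (- PI + h) = 2 * PI * mean f).
    rewrite <- E, !Rplus_0_r; unfold mean.
    rewrite <- Rmult_assoc, Rinv_r, Rmult_1_l by (generalize PI_RGT_0; lra).
    symmetry; apply (is_RInt_unique (V := R_CompleteNormedModule)).
    apply (is_RInt_derive (V := R_CompleteNormedModule) P); auto.
Qed.

(** The translation difference multiplies the j-th Fourier coefficient by exp(ijh) - 1, whose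
    squared modulus is 2 - 2 cos(jh). *)
Lemma energy_difference (f : R -> R) (h : R) (j : nat) : 0 < h ->
  (forall t, continuous f t) -> (forall t, f (t + 2 * PI) = f t) ->
  energy (fun t => f (t + h) - f t) j = (2 - 2 * cos (INR j * h)) * energy f j.
Proof.
  intros Hh Hc Hp.
  assert (HA := fcos_correct f j Hc); assert (HB := fsin_correct f j Hc).
  set (c := cos (INR j * h)); set (s := sin (INR j * h)).
  assert (Hper : forall t, cos (INR j * (t + 2 * PI - h)) = cos (INR j * (t - h)) /\
                           sin (INR j * (t + 2 * PI - h)) = sin (INR j * (t - h))).
  { intros t; replace (INR j * (t + 2 * PI - h)) with (INR j * (t - h) + 2 * INR j * PI) by ring.
    now rewrite cos_period, sin_period. }
  assert (M1 : is_mean (fun t => f (t + h) * cos (INR j * t)) (c * fcos f j + s * fsin f j)).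
  { replace (c * fcos f j + s * fsin f j) with (mean (fun t => f t * cos (INR j * (t - h)))).
    - eapply is_mean_ext; [|apply (is_mean_translate (fun t => f t * cos (INR j * (t - h))) h Hh)].
      + intros t; cbv beta; do 2 f_equal; ring.
      + intros t; apply continuous_Rmult; [apply Hc|].
        apply continuous_derivable; auto_derive; easy.
      + intros t; cbv beta; now rewrite Hp, (proj1 (Hper t)).
    - apply is_mean_unique; eapply is_mean_ext;
        [|apply is_mean_plus; apply is_mean_scal; [exact HA|exact HB]].
      intros t; cbv beta; unfold c, s.
      replace (INR j * (t - h)) with (INR j * t - INR j * h) by ring.
      rewrite cos_minus; ring. }
  assert (M2 : is_mean (fun t => f (t + h) * sin (INR j * t)) (c * fsin f j - s * fcos f j)).
  { replace (c * fsin f j - s * fcos f j) with (mean (fun t => f t * sin (INR j * (t - h)))).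
    - eapply is_mean_ext; [|apply (is_mean_translate (fun t => f t * sin (INR j * (t - h))) h Hh)].
      + intros t; cbv beta; do 2 f_equal; ring.
      + intros t; apply continuous_Rmult; [apply Hc|].
        apply continuous_derivable; auto_derive; easy.
      + intros t; cbv beta; now rewrite Hp, (proj2 (Hper t)).
    - apply is_mean_unique; eapply is_mean_ext;
        [|apply is_mean_minus; apply is_mean_scal; [exact HB|exact HA]].
      intros t; cbv beta; unfold c, s.
      replace (INR j * (t - h)) with (INR j * t - INR j * h) by ring.
      rewrite sin_minus; ring. }
  assert (E1 : fcos (fun t => f (t + h) - f t) j = c * fcos f j + s * fsin f j - fcos f j).
  { apply is_mean_unique; eapply is_mean_ext; [|apply is_mean_minus; [exact M1|exact HA]].
    intros t; cbv beta; ring. }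
  assert (E2 : fsin (fun t => f (t + h) - f t) j = c * fsin f j - s * fcos f j - fsin f j).
  { apply is_mean_unique; eapply is_mean_ext; [|apply is_mean_minus; [exact M2|exact HB]].
    intros t; cbv beta; ring. }
  unfold energy; rewrite E1, E2.
  assert (E : s ^ 2 = 1 - c ^ 2).
  { unfold s, c; generalize (sin2_cos2 (INR j * h)); unfold Rsqr; intros; nra. }
  transitivity ((c ^ 2 - 2 * c + 1 + s ^ 2) * (fcos f j ^ 2 + fsin f j ^ 2)); [ring|].
  rewrite E; ring.
Qed.

Lemma is_mean_sum (f : nat -> R -> R) (m : nat -> R) (n : nat) :
  (forall j, is_mean (f j) (m j)) ->
  is_mean (fun t => sum_f_R0 (fun j => f j t) n) (sum_f_R0 m n).
Proof.
  intros H; induction n as [|n IH]; simpl; [apply H|].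
  now apply (is_mean_plus (fun t => sum_f_R0 (fun j => f j t) n) (f (S n))).
Qed.

Lemma Re_ev_map_seq (a : nat -> C) (n : nat) (t : R) :
  Re (ev (map a (seq 0 (S n))) (eit t))
  = sum_f_R0 (fun j => fst (a j) * cos (INR j * t) - snd (a j) * sin (INR j * t)) n.
Proof.
  rewrite ev_map_seq; change (fun j => a (0 + j)%nat) with a.
  induction n as [|n IH].
  - rewrite poly_eval_0; simpl; rewrite Rmult_0_l, cos_0, sin_0; unfold Re; ring.
  - rewrite poly_eval_S, tech5, eit_pow, <- IH.
    generalize (poly_eval a n (eit t)); intros z; unfold eit, Re; simpl; ring.
Qed.

Lemma sumsq_map_seq (a : nat -> C) (n : nat) :
  sumsq (map a (seq 0 (S n))) = sum_f_R0 (fun j => nsq (a j)) n.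
Proof.
  assert (Happ : forall p q, sumsq (p ++ q) = sumsq p + sumsq q).
  { induction p as [|b p IHp]; intros q; simpl; [ring|]; rewrite IHp; ring. }
  induction n as [|n IH]; [simpl; ring|].
  rewrite seq_S, map_app, Happ, IH; simpl; ring.
Qed.

(** Let T be the sum of the terms of index 0 to n with the Fourier coefficients of f. Both f Re T
    and |T|^2 have the sum of energies as mean, and 2 f Re T <= f^2 + |T|^2 pointwise. *)
Lemma bessel (f : R -> R) (B : R) (n : nat) : (forall t, continuous f t) ->
  (forall t, Rabs (f t) <= B) -> sum_f_R0 (energy f) n <= B ^ 2.
Proof.
  intros Hc HB.
  set (a := fun j => (fcos f j, - fsin f j) : C).
  set (T := map a (seq 0 (S n))).
  assert (Hs : sumsq T = sum_f_R0 (energy f) n).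
  { unfold T; rewrite sumsq_map_seq; apply sum_eq; intros j _; unfold nsq, a, energy; simpl; ring. }
  assert (M1 : is_mean (fun t => f t * Re (ev T (eit t))) (sum_f_R0 (energy f) n)).
  { apply (is_mean_ext (fun t => sum_f_R0 (fun j =>
      fcos f j * (f t * cos (INR j * t)) + fsin f j * (f t * sin (INR j * t))) n)).
    - intros t; unfold T; rewrite Re_ev_map_seq, <- sum_f_R0_scal; apply sum_eq.
      intros j _; unfold a; simpl; ring.
    - apply (is_mean_sum (fun j t => fcos f j * (f t * cos (INR j * t)) + fsin f j * (f t * sin (INR j * t)))).
      intros j; eapply is_mean_eq; [|apply is_mean_plus; apply is_mean_scal;
        [now apply fcos_correct|now apply fsin_correct]].
      unfold energy; ring. }
  assert (M2 := parseval T); rewrite Hs in M2.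
  assert (H : 2 * sum_f_R0 (energy f) n <= B ^ 2 + sum_f_R0 (energy f) n).
  { eapply is_mean_le; [apply is_mean_scal, M1|
      apply is_mean_plus; [apply is_mean_const|exact M2]|].
    intros t _; cbv beta.
    assert (f t ^ 2 <= B ^ 2) by (rewrite <- (pow2_abs (f t)); apply pow_incr; split; [apply Rabs_pos|apply HB]).
    unfold nsq, Re; generalize (pow2_ge_0 (f t - fst (ev T (eit t)))) (pow2_ge_0 (snd (ev T (eit t)))).
    lra. }
  lra.
Qed.

(** For 0 <= v <= PI/2 one has sin v >= v - v^3/6 and v^2 <= 4. *)
Lemma sin_ge_third (u : R) : Rabs u <= PI / 2 -> Rabs u / 3 <= Rabs (sin u).
Proof.
  assert (H : forall u, 0 <= u <= PI / 2 -> u / 3 <= sin u).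
  { intros v Hv; assert (H4 := PI_4).
    destruct (pre_sin_bound v 0) as [H _]; try lra.
    unfold sin_approx, sin_term in H; simpl in H.
    eapply Rle_trans; [|exact H].
    assert (v * v <= 4) by nra.
    assert (v * (v * v) <= v * 4) by (apply Rmult_le_compat_l; lra). lra. }
  intros Hu; destruct (Rle_lt_dec 0 u) as [H0|H0].
  - rewrite (Rabs_pos_eq u) in * by easy.
    eapply Rle_trans; [apply H; lra|apply Rle_abs].
  - rewrite (Rabs_left u) in * by easy.
    rewrite <- Rabs_Ropp, <- sin_neg; eapply Rle_trans; [apply H; lra|apply Rle_abs].
Qed.

(** Bessel's inequality for f(t+h) - f(t), which is at most L h, with h = 1/(n+1). For j <= n the
    angle jh/2 is at most 1/2, so 4 sin(jh/2)^2 >= (jh)^2/9, and h^2 cancels. No derivative of f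
    enters. *)
Lemma energy_lipschitz (f : R -> R) (L : R) (n : nat) :
  (forall t, continuous f t) -> (forall t, f (t + 2 * PI) = f t) ->
  (forall x y, Rabs (f x - f y) <= L * Rabs (x - y)) ->
  sum_f_R0 (fun j => INR j ^ 2 * energy f j) n <= 9 * L ^ 2.
Proof.
  intros Hc Hp HL.
  set (h := / INR (S n)).
  assert (Hn : 0 < INR (S n)) by (apply lt_0_INR; lia).
  assert (Hh : 0 < h) by now apply Rinv_0_lt_compat.
  set (u := fun t => f (t + h) - f t).
  assert (HB : sum_f_R0 (energy u) n <= (L * h) ^ 2).
  { apply bessel.
    - intros t; apply (continuous_minus (V := R_NormedModule)); [|apply Hc].
      apply (continuous_comp (fun t => t + h) f); [|apply Hc].
      apply continuous_derivable; auto_derive; easy.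
    - intros t; unfold u; eapply Rle_trans; [apply HL|].
      replace (t + h - t) with h by ring; rewrite (Rabs_pos_eq h); lra. }
  assert (H : h ^ 2 / 9 * sum_f_R0 (fun j => INR j ^ 2 * energy f j) n <= (L * h) ^ 2).
  { eapply Rle_trans; [|exact HB]; rewrite <- sum_f_R0_scal; apply sum_Rle; intros j Hj.
    unfold u; rewrite energy_difference by auto.
    rewrite <- Rmult_assoc; apply Rmult_le_compat_r.
    - unfold energy; generalize (pow2_ge_0 (fcos f j)) (pow2_ge_0 (fsin f j)); lra.
    - assert (Hjh : 0 <= INR j * h <= 1).
      { split; [apply Rmult_le_pos; [apply pos_INR|lra]|].
        unfold h; apply Rle_div_l; [easy|]. rewrite Rmult_1_l; apply le_INR; lia. }
      replace (2 - 2 * cos (INR j * h)) with (4 * sin (INR j * h / 2) ^ 2).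
      2:{ replace (INR j * h) with (2 * (INR j * h / 2)) at 2 by field.
          rewrite cos_2a_sin; ring. }
      assert (E := sin_ge_third (INR j * h / 2)).
      rewrite Rabs_pos_eq in E by lra.
      assert (E' : INR j * h / 2 / 3 <= Rabs (sin (INR j * h / 2)))
        by (apply E; generalize PI2_1; lra).
      rewrite <- (pow2_abs (sin _)).
      assert ((INR j * h / 2 / 3) ^ 2 <= Rabs (sin (INR j * h / 2)) ^ 2) by (apply pow_incr; lra).
      lra. }
  apply (Rmult_le_reg_l (h ^ 2 / 9)); [apply Rdiv_lt_0_compat; [now apply pow_lt|lra]|].
  eapply Rle_trans; [exact H|]. right; field.
Qed.

(** * Fejer summation *)

Definition dirichlet (n : nat) (u : R) : R :=
  sum_f_R0 (fun j => (if Nat.eqb j 0 then 1 else 2) * cos (INR j * u)) n.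

Definition fejer_coef (n j : nat) : R :=
  (1 - INR j / INR (S n)) * (if Nat.eqb j 0 then 1 else 2).

(** The Fejer kernel in real form, normalised to have mean 1. *)
Definition fejer (n : nat) (u : R) : R :=
  sum_f_R0 (fun j => fejer_coef n j * cos (INR j * u)) n.

Lemma fejer_dirichlet (n : nat) (u : R) :
  INR (S n) * fejer n u = sum_f_R0 (fun i => dirichlet i u) n.
Proof.
  unfold fejer; rewrite <- sum_f_R0_scal.
  rewrite (sum_eq _ (fun j => (INR (S n) - INR j) * ((if Nat.eqb j 0 then 1 else 2) * cos (INR j * u)))).
  2:{ intros j _; unfold fejer_coef; field. apply not_0_INR; lia. }
  induction n as [|n IH]; [unfold dirichlet; simpl; ring|].
  rewrite (tech5 (fun i => dirichlet i u)), <- IH.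
  rewrite (sum_eq _ (fun j => (INR (S n) - INR j) * ((if Nat.eqb j 0 then 1 else 2) * cos (INR j * u))
     + (if Nat.eqb j 0 then 1 else 2) * cos (INR j * u))).
  2:{ intros j _; rewrite (S_INR (S n)); ring. }
  rewrite sum_plus, tech5; unfold dirichlet.
  replace (INR (S n) - INR (S n)) with 0 by ring. ring.
Qed.

(** The right side telescopes when summed over n. The factor 1 - cos u stays on the left, so the
    identity holds where it vanishes too. *)
Lemma dirichlet_closed (n : nat) (u : R) :
  (1 - cos u) * dirichlet n u = cos (INR n * u) - cos (INR (S n) * u).
Proof.
  unfold dirichlet; induction n as [|n IH].
  - simpl; rewrite !Rmult_0_l, cos_0, !Rmult_1_l; ring.
  - rewrite tech5, Rmult_plus_distr_l, IH; simpl Nat.eqb; cbv iota.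
    rewrite (S_INR (S n)).
    replace (INR n * u) with (INR (S n) * u - u) by (rewrite S_INR; ring).
    replace ((INR (S n) + 1) * u) with (INR (S n) * u + u) by ring.
    rewrite cos_minus, cos_plus; ring.
Qed.

Lemma fejer_closed (n : nat) (u : R) :
  (1 - cos u) * (INR (S n) * fejer n u) = 1 - cos (INR (S n) * u).
Proof.
  rewrite fejer_dirichlet, <- sum_f_R0_scal.
  rewrite (sum_eq _ (fun i => cos (INR i * u) - cos (INR (S i) * u)))
    by (intros; apply dirichlet_closed).
  induction n as [|n IH]; [simpl; rewrite Rmult_0_l, cos_0; ring|].
  rewrite tech5, IH; ring.
Qed.

Lemma fejer_pos (n : nat) (u : R) : 0 <= fejer n u.
Proof.
  assert (Hn : 0 < INR (S n)) by (apply lt_0_INR; lia).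
  apply (Rmult_le_reg_l (INR (S n))); [easy|]; rewrite Rmult_0_r.
  destruct (Rle_lt_dec 1 (cos u)) as [H|H].
  (* Here the closed form degenerates to 0 = 0, but every cos(ju) equals 1 and all terms are
     nonnegative. *)
  - assert (Hc : cos u = 1) by (apply Rle_antisym; [apply COS_bound|easy]).
    assert (Hs : sin u = 0).
    { generalize (sin2_cos2 u); rewrite Hc; unfold Rsqr; intros; nra. }
    assert (Hj : forall j, cos (INR j * u) = 1).
    { induction j as [|j IH]; [simpl; now rewrite Rmult_0_l, cos_0|].
      rewrite S_INR, Rmult_plus_distr_r, Rmult_1_l, cos_plus, IH, Hc, Hs; ring. }
    rewrite fejer_dirichlet; apply cond_pos_sum; intros i; apply cond_pos_sum; intros j.
    rewrite Hj; destruct (Nat.eqb j 0); lra.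
  - apply (Rmult_le_reg_l (1 - cos u)); [lra|].
    rewrite fejer_closed, Rmult_0_r; generalize (COS_bound (INR (S n) * u)); lra.
Qed.

(** The concentration of the kernel near 0: the closed form with 1 - cos u = 2 sin(u/2)^2, whose
    right side is at most 2. *)
Lemma fejer_sin_sq (n : nat) (u : R) : sin (u / 2) ^ 2 * fejer n u <= / INR (S n).
Proof.
  assert (Hn : 0 < INR (S n)) by (apply lt_0_INR; lia).
  apply (Rmult_le_reg_l (INR (S n))); [easy|]; rewrite Rinv_r by lra.
  assert (E : 1 - cos u = 2 * sin (u / 2) ^ 2).
  { replace u with (2 * (u / 2)) at 1 by field; rewrite cos_2a_sin; ring. }
  assert (H := fejer_closed n u); rewrite E in H.
  generalize (COS_bound (INR (S n) * u)); lra.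
Qed.

Lemma is_mean_fejer (n : nat) (x : R) : is_mean (fun s => fejer n (x - s)) 1.
Proof.
  apply (is_mean_eq _ (sum_f_R0 (fun j => if Nat.eqb j 0 then 1 else 0) n)).
  { induction n as [|n IH]; [reflexivity|]; rewrite tech5, IH; simpl; ring. }
  apply (is_mean_sum (fun j s => fejer_coef n j * cos (INR j * (x - s)))).
  intros [|j].
  - apply (is_mean_ext (fun _ => 1)); [|apply is_mean_const].
    intros s; unfold fejer_coef; simpl; rewrite Rmult_0_l, cos_0; unfold Rdiv; ring.
  - simpl Nat.eqb; cbv iota.
    apply (is_mean_ext (fun s => fejer_coef n (S j) * cos (INR (S j) * x) * cos (INR (S j) * s)
       + fejer_coef n (S j) * sin (INR (S j) * x) * sin (INR (S j) * s))).
    + intros s; replace (INR (S j) * (x - s)) with (INR (S j) * x - INR (S j) * s) by ring.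
      rewrite cos_minus; ring.
    + apply is_mean_trig; lia.
Qed.

Definition fejer_sum (f : R -> R) (n : nat) (x : R) : R :=
  sum_f_R0 (fun j => fejer_coef n j * (fcos f j * cos (INR j * x) + fsin f j * sin (INR j * x))) n.

Lemma is_mean_fejer_sum (f : R -> R) (n : nat) (x : R) : (forall t, continuous f t) ->
  is_mean (fun s => f s * fejer n (x - s)) (fejer_sum f n x).
Proof.
  intros Hc.
  apply (is_mean_ext (fun s => sum_f_R0 (fun j => fejer_coef n j
    * (cos (INR j * x) * (f s * cos (INR j * s)) + sin (INR j * x) * (f s * sin (INR j * s)))) n)).
  - intros s; unfold fejer; rewrite <- sum_f_R0_scal; apply sum_eq; intros j _.
    replace (INR j * (x - s)) with (INR j * x - INR j * s) by ring.
    rewrite cos_minus; ring.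
  - apply (is_mean_sum (fun j s => fejer_coef n j
      * (cos (INR j * x) * (f s * cos (INR j * s)) + sin (INR j * x) * (f s * sin (INR j * s))))).
    intros j; apply is_mean_scal; eapply is_mean_eq; [|apply is_mean_plus; apply is_mean_scal;
      [now apply fcos_correct|now apply fsin_correct]]. ring.
Qed.

(** The error is the mean of (f(s) - f(x)) against the positive kernel. The bound y <= d + y^2/d for
    y = |sin((x-s)/2)| reduces it to the mean of the kernel and [fejer_sin_sq]. *)
Lemma fejer_sum_error (f : R -> R) (n : nat) (x Lip d : R) :
  (forall t, continuous f t) -> 0 <= Lip -> 0 < d ->
  (forall s, - PI <= s <= PI -> Rabs (f s - f x) <= Lip * Rabs (sin ((x - s) / 2))) ->
  Rabs (fejer_sum f n x - f x) <= Lip * (d + / d * / INR (S n)).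
Proof.
  intros Hc HL Hd Hf.
  assert (M1 := is_mean_fejer_sum f n x Hc).
  assert (M2 := is_mean_fejer n x).
  assert (M3 := is_mean_minus _ _ _ _ M1 (is_mean_scal (f x) _ _ M2)).
  rewrite Rmult_1_r in M3.
  assert (M4 := is_mean_scal Lip _ _ (is_mean_plus _ _ _ _ (is_mean_scal d _ _ M2)
                  (is_mean_const (/ d * / INR (S n))))).
  rewrite Rmult_1_r in M4.
  assert (Hid : 0 < / d) by now apply Rinv_0_lt_compat.
  assert (Hpt : forall s, - PI <= s <= PI ->
    Rabs (f s * fejer n (x - s) - f x * fejer n (x - s))
    <= Lip * (d * fejer n (x - s) + / d * / INR (S n))).
  { intros s Hs; rewrite <- Rmult_minus_distr_r, Rabs_mult.
    assert (Hk := fejer_pos n (x - s)); rewrite (Rabs_pos_eq _ Hk).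
    eapply Rle_trans; [apply Rmult_le_compat_r; [exact Hk|apply (Hf s Hs)]|].
    rewrite Rmult_assoc; apply Rmult_le_compat_l; [easy|].
    assert (H := fejer_sin_sq n (x - s)); rewrite <- pow2_abs in H.
    set (y := Rabs (sin ((x - s) / 2))) in *.
    assert (Hy : y <= d + / d * y ^ 2).
    { assert (0 <= y) by apply Rabs_pos.
      destruct (Rle_lt_dec y d) as [Hyd|Hyd].
      - assert (0 <= / d * y ^ 2) by (apply Rmult_le_pos; [lra|apply pow2_ge_0]); lra.
      - assert (y <= / d * y ^ 2); [|lra].
        apply (Rmult_le_reg_l d); [easy|]. rewrite <- Rmult_assoc, Rinv_r by lra. nra. }
    apply Rle_trans with ((d + / d * y ^ 2) * fejer n (x - s)); [now apply Rmult_le_compat_r|].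
    rewrite Rmult_plus_distr_r; apply Rplus_le_compat_l.
    rewrite Rmult_assoc; apply Rmult_le_compat_l; lra. }
  apply Rabs_le; split.
  - apply Ropp_le_cancel; rewrite Ropp_involutive.
    replace (- (fejer_sum f n x - f x)) with (-1 * (fejer_sum f n x - f x)) by ring.
    eapply is_mean_le; [apply is_mean_scal, M3|exact M4|].
    intros s Hs; cbv beta; specialize (Hpt s Hs); apply Rabs_le_between in Hpt; lra.
  - eapply is_mean_le; [exact M3|exact M4|].
    intros s Hs; cbv beta; specialize (Hpt s Hs); apply Rabs_le_between in Hpt; lra.
Qed.

Lemma coef_map_seq (a : nat -> C) (s l j : nat) :
  coef (map a (seq s l)) j = if Nat.ltb j l then a (s + j)%nat else RtoC 0.
Proof.
  revert s j; induction l as [|l IH]; intros s j; [now rewrite coef_nil|].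
  destruct j as [|j]; [simpl; now rewrite Nat.add_0_r|].
  change (coef (map a (seq (S s) l)) j = if Nat.ltb (S j) (S l) then a (s + S j)%nat else RtoC 0).
  rewrite IH; change (Nat.ltb (S j) (S l)) with (Nat.ltb j l).
  now replace (S s + j)%nat with (s + S j)%nat by lia.
Qed.

Lemma energy_pos (f : R -> R) (j : nat) : 0 <= energy f j.
Proof. unfold energy; generalize (pow2_ge_0 (fcos f j)) (pow2_ge_0 (fsin f j)); lra. Qed.

Lemma wt_le (k j : nat) : (1 <= j)%nat -> wt k j <= 4 ^ k * INR j ^ (2 * k).
Proof.
  intros Hj; unfold wt; rewrite !pow_mult, <- Rpow_mult_distr.
  apply pow_incr; split; [apply pow2_ge_0|].
  assert (1 <= INR j) by (apply (le_INR 1); lia). rewrite S_INR; nra.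
Qed.

Lemma fejer_approximable (k : nat) (V : R -> R) (Lip B : R) :
  (forall t, continuous V t) -> 0 < Lip ->
  (forall x s, - PI <= x <= PI -> - PI <= s <= PI ->
     Rabs (V s - V x) <= Lip * Rabs (sin ((x - s) / 2))) ->
  (forall M, sum_f_R0 (fun j => INR j ^ (2 * k) * energy V j) M <= B) ->
  trig_approximable k (4 ^ k * B) (mean V) V.
Proof.
  intros Hc HL HV HB eps Heps.
  (* Then Lip d = eps/2, and the choice of [n] makes the second error term 1/(d (n+1)) at most d. *)
  set (d := eps / (2 * Lip)); assert (Hd : 0 < d) by (apply Rdiv_lt_0_compat; lra).
  destruct (nfloor_ex (4 * Lip ^ 2 / eps ^ 2)) as [n [_ Hn]].
  { apply Rdiv_le_0_compat; [generalize (pow2_ge_0 Lip); lra|apply pow_lt; lra]. }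
  rewrite <- S_INR in Hn.
  assert (HSn : 0 < INR (S n)) by (apply lt_0_INR; lia).
  (* The Fejer-damped Fourier coefficients of positive index. The constant term is [mean V], and the
     factor 2 in [fejer_coef] comes from 2 Re. *)
  set (a := fun j => if Nat.eqb j 0 then RtoC 0 else
    ((1 - INR j / INR (S n)) * fcos V j, - ((1 - INR j / INR (S n)) * fsin V j)) : C).
  exists (map a (seq 0 (S n))); repeat split.
  - intros M; eapply Rle_trans; [|apply Rmult_le_compat_l; [apply pow_le; lra|apply (HB M)]].
    unfold wnorm; rewrite <- sum_f_R0_scal; apply sum_Rle; intros j _.
    assert (Hpos : 0 <= 4 ^ k * (INR j ^ (2 * k) * energy V j)).
    { apply Rmult_le_pos; [apply pow_le; lra|]. apply Rmult_le_pos; [apply pow_le, pos_INR|apply energy_pos]. }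
    rewrite coef_map_seq; simpl (0 + j)%nat.
    assert (Hz : nsq (RtoC 0) = 0) by (unfold nsq; simpl; ring).
    destruct (Nat.ltb_spec j (S n)) as [Hj|Hj]; [|rewrite Hz, Rmult_0_r; exact Hpos].
    unfold a; destruct (Nat.eqb_spec j 0) as [->|Hj0]; [rewrite Hz, Rmult_0_r; exact Hpos|].
    rewrite <- Rmult_assoc; apply Rmult_le_compat; [left; apply wt_pos|apply nsq_pos|apply wt_le; lia|].
    assert (H0 : 0 <= INR j / INR (S n)) by (apply Rdiv_le_0_compat; [apply pos_INR|easy]).
    assert (H1 : INR j / INR (S n) <= 1) by (apply Rle_div_l; [easy|]; rewrite Rmult_1_l; apply le_INR; lia).
    revert H0 H1; generalize (INR j / INR (S n)); intros r H0 H1.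
    unfold nsq; simpl fst; simpl snd; unfold energy.
    replace (((1 - r) * fcos V j) ^ 2 + (- ((1 - r) * fsin V j)) ^ 2)
      with ((1 - r) ^ 2 * energy V j) by (unfold energy; ring).
    assert (He := energy_pos V j); fold (energy V j).
    assert ((1 - r) ^ 2 <= 1) by nra.
    rewrite <- (Rmult_1_l (energy V j)) at 2. now apply Rmult_le_compat_r.
  - intros x Hx.
    assert (E : mean V + 2 * Re (ev (map a (seq 0 (S n))) (eit x)) = fejer_sum V n x).
    { rewrite Re_ev_map_seq; unfold fejer_sum.
      assert (HG : forall (F G : nat -> R) N, F 0%nat = mean V -> G 0%nat = 0 ->
        (forall j, F (S j) = 2 * G (S j)) -> mean V + 2 * sum_f_R0 G N = sum_f_R0 F N).
      { intros F G N HF HG0 HFG; induction N as [|N IH]; [simpl; rewrite HF, HG0; ring|].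
        rewrite !tech5, <- IH, HFG; ring. }
      apply HG.
      - assert (fcos V 0 = mean V) as ->.
        { apply is_mean_unique; eapply is_mean_ext; [|apply is_mean_continuous, Hc].
          intros t; simpl; rewrite Rmult_0_l, cos_0; ring. }
        unfold fejer_coef; simpl; rewrite Rmult_0_l, cos_0, sin_0; unfold Rdiv; ring.
      - unfold a; simpl; ring.
      - intros j; unfold a, fejer_coef; simpl Nat.eqb; cbv iota; cbv [fst snd]; ring. }
    rewrite E, Rabs_minus_sym.
    eapply Rle_trans; [apply (fejer_sum_error V n x Lip d Hc); [lra|easy|intros; now apply HV]|].
    assert (E2 : 4 * Lip ^ 2 < INR (S n) * eps ^ 2).
    { apply (Rmult_lt_compat_r (eps ^ 2)) in Hn; [|apply pow_lt; lra].
      unfold Rdiv in Hn; rewrite Rmult_assoc, Rinv_l in Hn; [lra|]. apply pow_nonzero; lra. }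
    assert (E3 : / d * / INR (S n) <= d).
    { apply (Rmult_le_reg_l d); [easy|]. rewrite <- Rmult_assoc, Rinv_r, Rmult_1_l by lra.
      apply (Rmult_le_reg_l (INR (S n))); [easy|]. rewrite Rinv_r by lra.
      unfold d; replace (INR (S n) * (eps / (2 * Lip) * (eps / (2 * Lip))))
        with (INR (S n) * eps ^ 2 / (4 * Lip ^ 2)) by (field; lra).
      apply Rle_div_r; [|lra]. generalize (pow_lt Lip 2 HL); lra. }
    apply Rle_trans with (Lip * (d + d)); [apply Rmult_le_compat_l; lra|].
    unfold d; right; field; lra.
Qed.

(** * Functions of class C^{k-1,1} *)

Lemma lipschitz_continuous (f : R -> R) (L : R) (x : R) :
  (forall x y, Rabs (f x - f y) <= L * Rabs (x - y)) -> continuous f x.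
Proof.
  intros HL; apply filterlim_locally; intros eps.
  assert (HL0 : 0 <= L).
  { generalize (HL 1 0); rewrite Rminus_0_r, Rabs_R1; generalize (Rabs_pos (f 1 - f 0)); lra. }
  assert (Hd : 0 < eps / (L + 1)) by (apply Rdiv_lt_0_compat; [apply cond_pos|lra]).
  exists (mkposreal _ Hd); intros y Hy.
  change (Rabs (f y - f x) < eps); change (Rabs (y - x) < eps / (L + 1)) in Hy.
  eapply Rle_lt_trans; [apply HL|].
  apply Rle_lt_trans with ((L + 1) * Rabs (y - x)).
  - apply Rmult_le_compat_r; [apply Rabs_pos|lra].
  - apply (Rmult_lt_compat_l (L + 1)) in Hy; [|lra].
    replace ((L + 1) * (eps / (L + 1))) with (pos eps) in Hy by (field; lra). exact Hy.
Qed.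

Lemma continuous_bounded (f : R -> R) (a b : R) : a <= b -> (forall t, continuous f t) ->
  exists M, forall t, a <= t <= b -> f t <= M.
Proof.
  intros Hab Hc; destruct (continuity_ab_maj f a b Hab) as [x [Hx _]].
  - intros c _; apply continuity_pt_filterlim, Hc.
  - now exists (f x).
Qed.

Section Class.
Variables (k : nat) (V : R -> R).
Hypothesis Hk : (1 <= k)%nat.
Hypothesis HV : C_k_minus_1_1_S1 k V.

Lemma class_derive (i : nat) (x : R) : (i < k - 1)%nat ->
  is_derive (Derive_n V i) x (Derive_n V (S i) x).
Proof.
  intros Hi; apply Derive_correct; destruct HV as [_ [H _]].
  apply (H (S i) x); lia.
Qed.

Lemma class_continuous (i : nat) (x : R) : (i <= k - 1)%nat -> continuous (Derive_n V i) x.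
Proof.
  intros Hi; destruct (Nat.eq_dec i (k - 1)) as [->|Hne].
  - destruct HV as [_ [_ [L HL]]]; now apply (lipschitz_continuous _ L).
  - apply continuous_derivable; eexists; apply class_derive; lia.
Qed.

Lemma class_periodic (i : nat) (x : R) : Derive_n V i (x + 2 * PI) = Derive_n V i x.
Proof.
  rewrite <- (Derive_n_comp_trans V i x (2 * PI)).
  apply Derive_n_ext; intros t; apply HV.
Qed.

Lemma energy_Derive_n (i j : nat) : (i <= k - 1)%nat ->
  energy (Derive_n V i) j = INR j ^ (2 * i) * energy V j.
Proof.
  induction i as [|i IH]; intros Hi; [change (Derive_n V 0) with V; simpl; ring|].
  rewrite (energy_derive (Derive_n V i) (Derive_n V (S i))).
  - rewrite IH by lia. replace (2 * S i)%nat with (2 + 2 * i)%nat by lia.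
    rewrite pow_add; ring.
  - intros t; apply class_derive; lia.
  - intros t; now apply class_continuous.
  - rewrite <- (class_periodic i (- PI)); f_equal; ring.
Qed.

(** k-1 integrations by parts transfer the factor j^(2(k-1)) to the energy of the Lipschitz
    derivative, and [energy_lipschitz] supplies j^2. *)
Lemma class_energy : exists B, forall M,
  sum_f_R0 (fun j => INR j ^ (2 * k) * energy V j) M <= B.
Proof.
  destruct HV as [_ [_ [L HL]]]; exists (9 * L ^ 2); intros M.
  eapply Rle_trans; [|apply (energy_lipschitz (Derive_n V (k - 1)) L M)]; auto.
  - right; apply sum_eq; intros j _; rewrite energy_Derive_n by lia.
    replace (2 * k)%nat with (2 + 2 * (k - 1))%nat by lia. rewrite pow_add; ring.
  - intros t; now apply class_continuous.
  - intros t; apply class_periodic.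
Qed.

(** For k = 1 this is the hypothesis; for larger k, V' is continuous, hence bounded on a compact
    interval. The range 3 PI leaves room for a shift by one period. *)
Lemma class_lipschitz_local : exists L, 0 < L /\ forall x y,
  - (3 * PI) <= x <= 3 * PI -> - (3 * PI) <= y <= 3 * PI ->
  Rabs (V x - V y) <= L * Rabs (x - y).
Proof.
  destruct (Nat.eq_dec k 1) as [E|Hne].
  - destruct HV as [_ [_ [L HL]]]; rewrite E in HL; simpl in HL.
    exists (Rabs L + 1); split; [generalize (Rabs_pos L); lra|]; intros x y _ _.
    eapply Rle_trans; [apply HL|]; apply Rmult_le_compat_r; [apply Rabs_pos|].
    generalize (Rle_abs L); lra.
  (* Intermediate points t satisfy |t - y| <= |x - y| <= 6 PI with |y| <= 3 PI, hence |t| <= 9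
     PI. *)
  - destruct (continuous_bounded (fun t => Rabs (Derive_n V 1 t)) (- (9 * PI)) (9 * PI)) as [M HM].
    + generalize PI_RGT_0; lra.
    + intros t; apply (continuous_comp (Derive_n V 1) Rabs); [apply class_continuous; lia|].
      apply continuous_Rabs.
    + exists (Rabs M + 1); split; [generalize (Rabs_pos M); lra|]; intros x y Hx Hy.
      apply (bounded_variation V (Derive_n V 1) (Rabs M + 1) y x); intros t Ht.
      split; [apply (class_derive 0); lia|].
      eapply Rle_trans; [apply HM|generalize (Rle_abs M); lra].
      assert (Rabs (x - y) <= 6 * PI) by (apply Rabs_le; lra).
      assert (Ht' : Rabs (t - y) <= 6 * PI) by lra.
      apply Rabs_le_between in Ht'; lra.
Qed.

(** |sin((x-s)/2)| is half the chord between the two points of the circle. When |x - s| > PI,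
    shifting x by a period brings the points within PI and only changes the sign of the sine. The
    factor 6 is from [sin_ge_third] at half the angle. *)
Lemma class_lipschitz_circle : exists L, 0 < L /\ forall x s,
  - PI <= x <= PI -> - PI <= s <= PI ->
  Rabs (V s - V x) <= L * Rabs (sin ((x - s) / 2)).
Proof.
  destruct class_lipschitz_local as [L [HL H]].
  exists (6 * L); split; [lra|].
  assert (Hsmall : forall x s, - (3 * PI) <= x <= 3 * PI -> - (3 * PI) <= s <= 3 * PI ->
    Rabs (x - s) <= PI -> Rabs (V s - V x) <= 6 * L * Rabs (sin ((x - s) / 2))).
  { intros x s Hx Hs Hxs; rewrite Rabs_minus_sym; eapply Rle_trans; [now apply H|].
    assert (E : Rabs ((x - s) / 2) = Rabs (x - s) / 2)
      by (unfold Rdiv; rewrite Rabs_mult, (Rabs_pos_eq (/ 2)); lra).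
    assert (S := sin_ge_third ((x - s) / 2)); rewrite E in S.
    assert (S' : Rabs (x - s) / 2 / 3 <= Rabs (sin ((x - s) / 2))) by (apply S; lra).
    assert (L * Rabs (x - s) <= L * (6 * Rabs (sin ((x - s) / 2))))
      by (apply Rmult_le_compat_l; lra). lra. }
  assert (Hper := proj1 HV); assert (HPI := PI_RGT_0).
  intros x s Hx Hs.
  destruct (Rle_lt_dec (x - s) PI) as [H1|H1]; [destruct (Rle_lt_dec (- PI) (x - s)) as [H2|H2]|].
  - apply Hsmall; try lra. apply Rabs_le; lra.
  - rewrite <- (Hper x).
    replace (Rabs (sin ((x - s) / 2))) with (Rabs (sin ((x + 2 * PI - s) / 2))).
    + apply Hsmall; try lra. apply Rabs_le; lra.
    + replace ((x + 2 * PI - s) / 2) with ((x - s) / 2 + PI) by field.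
      now rewrite neg_sin, Rabs_Ropp.
  - replace (V x) with (V (x - 2 * PI)) by (rewrite <- Hper; f_equal; ring).
    replace (Rabs (sin ((x - s) / 2))) with (Rabs (sin ((x - 2 * PI - s) / 2))).
    + apply Hsmall; try lra. apply Rabs_le; lra.
    + replace ((x - s) / 2) with ((x - 2 * PI - s) / 2 + PI) by field.
      now rewrite neg_sin, Rabs_Ropp.
Qed.

End Class.

Theorem theorem3p7 (k : nat) (V : R -> R) (p : nat -> nat -> C) :
  (1 <= k)%nat ->
  C_k_minus_1_1_S1 k V ->
  orthonormal_family (fun t => exp (- V t)) p ->
  let V0 := / (2 * PI) * RInt V (- PI) PI in
  exists K : R, 0 < K /\
    exists N : nat, forall n : nat, (N <= n)%nat ->
      Rabs ((Re (p n n)) ^ 2 * exp (- V0) - 1) <= K * ln (INR n) / (INR n) ^ (2 * k).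
Proof.
  intros Hk HV Hp V0.
  assert (Hc : forall t, continuous V t) by (intros t; apply (class_continuous k V Hk HV 0); lia).
  destruct (class_lipschitz_circle k V Hk HV) as [Lip [HL HLip]].
  destruct (class_energy k V Hk HV) as [B HB].
  assert (HT : trig_approximable k (4 ^ k * B) V0 V) by now apply (fejer_approximable k V Lip B).
  destruct (continuous_bounded (fun t => exp (- V t)) (- PI) PI) as [Phi HPhi].
  { generalize PI_RGT_0; lra. }
  { intros t; apply (continuous_comp (fun t => - V t) exp).
    - apply (continuous_opp (V := R_NormedModule)), Hc.
    - apply continuous_derivable; auto_derive; easy. }
  set (K := 2 * (exp (V0 + 2) * Phi) * exp (1 + 4 * 4 ^ k * (4 ^ k * B))).
  assert (HK : 0 <= K).
  { assert (0 <= Phi) by (eapply Rle_trans; [left; apply (exp_pos (- V 0))|apply HPhi; generalize PI_RGT_0; lra]).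
    unfold K; repeat apply Rmult_le_pos; auto; try (left; apply exp_pos); lra. }
  (* The added 1 makes the constant positive, and n >= 3 > e gives ln n >= 1. *)
  exists (K + 1); split; [lra|]; exists 3%nat; intros n Hn.
  destruct (leading_coef_bounds k (4 ^ k * B) V0 Phi V p n) as [H1 H2]; auto; [lia|].
  fold K in H2; set (x := Re (p n n) ^ 2 * exp (- V0)) in *.
  assert (Hx : 0 <= x) by (apply Rmult_le_pos; [apply pow2_ge_0|left; apply exp_pos]).
  assert (Hn0 : 0 < INR n ^ (2 * k)) by (apply pow_lt, lt_0_INR; lia).
  assert (Hln : 1 <= ln (INR n)).
  { rewrite <- (ln_exp 1); apply ln_le; [apply exp_pos|].
    eapply Rle_trans; [apply exp_le_3|]. apply (le_INR 3) in Hn; simpl in Hn; lra. }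
  assert (HKn : 0 <= K / INR n ^ (2 * k)) by (apply Rdiv_le_0_compat; lra).
  rewrite Rabs_left1 by lra.
  (* From x <= 1 and 1 <= x (1 + K/n^(2k)) follows 1 - x <= x K/n^(2k) <= K/n^(2k). *)
  apply Rle_trans with (K / INR n ^ (2 * k)); [nra|].
  apply Rmult_le_compat_r; [left; now apply Rinv_0_lt_compat|nra].
Qed.
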